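(* Let $r \ge 1$, $a \ge 2$, $t \ge 1$ and $s \ge 0$ be integers. Then $\sigma(r,s,a,t) \le r \left\lceil \frac{tr+s+1}{a}\right\rceil + (t-1)r + 1$.
   Context: All graphs are finite simple graphs. A $(d,d+s)$-graph is a graph all of whose vertex degrees lie in $\{d, \ldots, d+s\}$. An $(r,r+a)$-factor of $G$ is a spanning subgraph all of whose degrees lie in $\{r,\ldots,r+a\}$; an $(r,r+a)$-factorization of $G$ with $x$ factors is a decomposition of $E(G)$ into $x$ edge-disjoint $(r,r+a)$-factors. $\sigma(r,s,a,t)$ is the least integer such that, whenever $d \ge \sigma(r,s,a,t)$, every simple $(d,d+s)$-graph has an $(r,r+a)$-factorization with $x$ factors for at least $t$ different values of $x$. *)

(* Defs.v *)
From mathcomp Require Import all_boot all_order all_algebra.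

Set Implicit Arguments.
Unset Strict Implicit.
Unset Printing Implicit Defensive.

(** A finite simple graph with vertex set [T] is its adjacency relation. *)
Definition simple_graph (T : finType) (e : rel T) : Prop :=
  symmetric e /\ irreflexive e.

Definition degree (T : finType) (e : rel T) (v : T) : nat := #|[pred u | e v u]|.

Definition degrees_in (T : finType) (e : rel T) (m n : nat) : Prop :=
  forall v, m <= degree e v <= n.

(** A (d,d+s)-graph; [T] may be empty. *)
Definition degree_graph (T : finType) (e : rel T) (d s : nat) : Prop :=
  simple_graph e /\ degrees_in e d (d + s).

(** Factors are spanning because [e] and [f] are relations on the same [T]. *)
Definition factor (T : finType) (e f : rel T) (r a : nat) : Prop :=
  [/\ simple_graph f, subrel f e & degrees_in f r (r + a)].

Definition factorization (T : finType) (e : rel T) (r a x : nat)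
    (F : 'I_x -> rel T) : Prop :=
  (forall i, factor e (F i) r a) /\
  (forall u v, e u v -> exists! i, F i u v).

Definition has_factorization (T : finType) (e : rel T) (r a x : nat) : Prop :=
  exists F : 'I_x -> rel T, factorization e r a F.

Definition at_least (t : nat) (P : nat -> Prop) : Prop :=
  exists xs : seq nat, [/\ uniq xs, size xs = t & forall x, x \in xs -> P x].

Definition sigma_bound (r s a t D : nat) : Prop :=
  forall d : nat, D <= d ->
  forall (T : finType) (e : rel T), degree_graph e d s ->
  at_least t (has_factorization e r a).

(** sigma(r,s,a,t) exists and equals [m]. The least element is taken among
    natural numbers, [d] being a bound on vertex degrees. *)
Definition is_sigma (r s a t m : nat) : Prop :=
  sigma_bound r s a t m /\ forall D, sigma_bound r s a t D -> m <= D.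

(* Main.v *)
(** Fix [k] colours and a simple graph none of whose positive degrees is divisible
    by [k].  Among all edge colourings take one minimising the sum over vertices and
    colours of the squares of the colour degrees; it turns out to be equitable, i.e.
    two colour degrees at a vertex differ by at most 1 (Hilton and de Werra).
    Otherwise some vertex [v] has colours [a], [b] whose degrees differ by 2.  Flipping
    alternating trails shows that every neighbour [w] of [v] along colour [a] has equal
    [a]- and [b]-degrees; as [k] does not divide the degree of [w], some colour [c] has
    another degree at [w], and the excess at [v] can be shifted from [a] to [c] without
    increasing the potential.  Iterating gives a Vizing fan at [v] whose colours never
    repeat, which is impossible.  Simplicity enters because distinct fan edges lead to
    distinct vertices.

    A general graph is reduced to this case by attaching a pendant edge to each vertex
    whose degree is divisible by [k].  After deleting the pendant edges, degrees strictly
    between [r k] and [(r + a) k] yield colour degrees in [r, r + a].  If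
    [d >= r q + (t - 1) r + 1] and [a q >= t r + s + 1], this applies to the [t] values
    [k = X - t + 1, ..., X] where [X = (d - 1) / r]. *)
Require Import Defs.
From mathcomp Require Import all_boot all_order all_algebra.
From mathcomp Require Import zify.
From Stdlib Require Import Classical.

Set Implicit Arguments.
Unset Strict Implicit.
Unset Printing Implicit Defensive.

(** * Alternating walks of two involutions *)

Section TwoInvolutions.

Variables (D : finType) (rev pi : D -> D).
Hypotheses (revK : involutive rev) (piK : involutive pi).

Let step z := rev (pi z).

Definition walk := connect (frel step).

(** The point opposite to [x] on its [step]-cycle. If [pi] fixes [x] and [rev] fixes no point of the
    cycle, this is the other end of the alternating walk from [x]. *)
Definition mate x := iter (order step x)./2 step x.

Lemma step_inj : injective step.
Proof. exact: inj_comp (inv_inj revK) (inv_inj piK). Qed.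

Lemma iter_step_inj i : injective (iter i step).
Proof. by elim: i => [|i IHi] y z //= /step_inj/IHi. Qed.

Lemma walk_sym : symmetric walk.
Proof. exact: fconnect_sym step_inj. Qed.

(** Conjugation by [pi] inverts [step]. On the walk of a fixed point of [pi], the involution [pi]
    therefore reflects positions by i -> -i, and [rev] by i -> 1 - i. *)
Lemma iter_step_pi i z : iter i step (pi (iter i step z)) = pi z.
Proof.
elim: i z => [|i IHi] z //; rewrite iterSr [iter i.+1 _ z]/=.
by rewrite /step piK revK -/step IHi.
Qed.

Variable x : D.
Hypothesis x_fix : pi x = x.

Lemma walk_pi z : walk x z -> walk x (pi z).
Proof.
move=> /iter_findex <-; rewrite walk_sym.
set i := findex step x z; have := fconnect_iter step i (pi (iter i step x)).
by rewrite iter_step_pi x_fix.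
Qed.

Lemma walk_rev z : walk x z -> walk x (rev z).
Proof.
move=> /walk_pi xz; apply: connect_trans xz _.
by rewrite -{2}[z]piK; apply: fconnect1.
Qed.

Hypothesis rev_free : forall z, walk x z -> rev z <> z.

(** On a cycle of length 2m + 1 the reflection i -> 1 - i would fix position m + 1, against
    [rev_free]. *)
Lemma order_walk_even : ~~ odd (order step x).
Proof.
apply/negP => on; set n := order step x in on.
pose z := iter n./2.+1 step x.
have xz : walk x z by apply: fconnect_iter.
apply: (rev_free xz); apply: (@iter_step_inj (n./2)).
rewrite -[in rev z](piK z) -/(step (pi z)) -iterSr iter_step_pi x_fix.
rewrite /z -iterD; have -> : n./2 + n./2.+1 = n.
  by rewrite addnS addnn -[RHS]odd_double_half on.
by rewrite (iter_order step_inj).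
Qed.

Lemma half_order_gt0 : 0 < (order step x)./2.
Proof.
have := order_gt0 step x; have := odd_double_half (order step x).
by rewrite (negbTE order_walk_even); case: _./2 => // <-.
Qed.

Lemma mate_walk : walk x (mate x).
Proof. exact: fconnect_iter. Qed.

Lemma mate_neq : mate x <> x.
Proof.
move=> E; have h0 := half_order_gt0.
have lt : (order step x)./2 < order step x.
  by rewrite -divn2 ltn_Pdiv ?order_gt0.
by have := findex_iter lt; rewrite -/(mate x) E findex0 => h; rewrite -h in h0.
Qed.

Lemma mate_fix : pi (mate x) = mate x.
Proof.
apply: (@iter_step_inj (order step x)./2).
rewrite iter_step_pi x_fix /mate -iterD addnn.
have := odd_double_half (order step x).
by rewrite (negbTE order_walk_even) add0n => ->; rewrite (iter_order step_inj).
Qed.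

(** Position i is fixed by the reflection i -> -i only if the order divides 2i, so i is 0 or half
    the order. *)
Lemma walk_fix z : walk x z -> pi z = z -> z = x \/ z = mate x.
Proof.
move=> xz zf; have zE := iter_findex xz.
have lt : findex step x z < order step x by rewrite findex_max.
set i := findex step x z in zE lt.
have E : iter (i + i) step x = x by rewrite iterD zE -zf -[in pi z]zE iter_step_pi.
have h2 := odd_double_half (order step x); rewrite (negbTE order_walk_even) add0n in h2.
case: (ltnP (i + i) (order step x)) => c.
  have := findex_iter c; rewrite E findex0 => /esym/eqP.
  by rewrite addn_eq0 => /andP[/eqP i0 _]; left; rewrite -zE i0.
right; rewrite /mate -zE; congr (iter _ _ _).
have lt2 : i + i - order step x < order step x by lia.
have : iter (i + i - order step x) step x = x.
  by move: E; rewrite -{1}(subnK c) iterD (iter_order step_inj).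
move/(congr1 (findex step x)); rewrite (findex_iter lt2) findex0; lia.
Qed.

End TwoInvolutions.

Lemma mateK (D : finType) (rev pi : D -> D) (x : D) :
    involutive rev -> involutive pi -> pi x = x ->
    (forall z, walk rev pi x z -> rev z <> z) ->
  mate rev pi (mate rev pi x) = x.
Proof.
move=> revK piK xf free; set y := mate rev pi x.
have xy : walk rev pi x y by apply: mate_walk.
have yf : pi y = y by apply: mate_fix.
have free' z : walk rev pi y z -> rev z <> z.
  by move=> yz; apply: free; apply: connect_trans xy yz.
have xz : walk rev pi x (mate rev pi y).
  by apply: connect_trans xy _; apply: mate_walk.
have [] // := walk_fix revK piK xf free xz (mate_fix revK piK yf free').
by move/(mate_neq revK piK yf free').
Qed.

(** * Pairing off two disjoint lists *)

Section Pairing.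

Variable T : finType.
Implicit Types s t : seq T.

(* An index beyond the end of the other list returns the default, so the surplus
   of the longer list is fixed. *)
Definition pairing s t y :=
  if y \in s then nth y t (index y s)
  else if y \in t then nth y s (index y t) else y.

Definition disjoint_uniq s t := [/\ uniq s, uniq t & forall y, y \in s -> y \notin t].

Lemma disjoint_uniqC s t : disjoint_uniq s t -> disjoint_uniq t s.
Proof. by case=> us ut d; split=> // y yt; apply/negP => /d; rewrite yt. Qed.

Lemma pairingC s t : disjoint_uniq s t -> pairing s t =1 pairing t s.
Proof.
move=> [_ _ d] y; rewrite /pairing; case: ifP => // ys.
by rewrite (negbTE (d _ ys)).
Qed.

Lemma pairing_mem s t y :
  y \in s -> pairing s t y != y -> pairing s t y \in t.
Proof.
rewrite /pairing => ->; case: (ltnP (index y s) (size t)) => c.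
  by rewrite mem_nth.
by rewrite nth_default ?eqxx.
Qed.

Lemma pairing_move s t y :
  disjoint_uniq s t -> size s <= size t -> y \in s -> pairing s t y != y.
Proof.
move=> [us ut d] le ys; rewrite /pairing ys; apply/eqP => E.
have := d _ ys; rewrite -{1}E mem_nth //.
by apply: leq_trans le; rewrite index_mem.
Qed.

Lemma pairingK s t : disjoint_uniq s t -> involutive (pairing s t).
Proof.
have aux s' t' y : disjoint_uniq s' t' -> y \in s' ->
    pairing s' t' (pairing s' t' y) = y.
  move=> [us ut d] ys; have [E|ne] := eqVneq (pairing s' t' y) y.
    by rewrite !E.
  have yt := pairing_mem ys ne.
  have ns : pairing s' t' y \notin s' by apply/negP => /d; rewrite yt.
  rewrite {1}/pairing (negbTE ns) yt {2}/pairing ys.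
  have lt : index y s' < size t'.
    rewrite ltnNge; apply: contraNN ne => c.
    by rewrite /pairing ys nth_default.
  by rewrite index_uniq // nth_index.
move=> du y; have [ys|ys] := boolP (y \in s); first exact: aux.
have [yt|yt] := boolP (y \in t).
  by rewrite !(pairingC du); apply: aux => //; apply: disjoint_uniqC.
have E : pairing s t y = y by rewrite /pairing (negbTE ys) (negbTE yt).
by rewrite !E.
Qed.

(** [pairing s t] is itself a bijection between the moved elements of [s] and those of [t]. *)
Lemma card_pairing s t (P : pred T) : disjoint_uniq s t ->
    (forall y, P y -> P (pairing s t y)) ->
  #|[pred y | [&& y \in s, P y & pairing s t y != y]]|
    = #|[pred y | [&& y \in t, P y & pairing s t y != y]]|.
Proof.
have aux s' t' : disjoint_uniq s' t' -> (forall y, P y -> P (pairing s' t' y)) ->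
  #|[pred y | [&& y \in s', P y & pairing s' t' y != y]]|
    <= #|[pred y | [&& y \in t', P y & pairing s' t' y != y]]|.
  move=> du cl; have inj := inv_inj (pairingK du).
  rewrite -(card_image inj) subset_leq_card //; apply/subsetP => z /imageP[y].
  rewrite !inE => /and3P[ys Py ne] ->.
  by rewrite pairing_mem // cl // pairingK // eq_sym.
move=> du cl; apply/eqP; rewrite eqn_leq aux //=.
have eqc (u : seq T) : #|[pred y | [&& y \in u, P y & pairing s t y != y]]|
    = #|[pred y | [&& y \in u, P y & pairing t s y != y]]|.
  by apply: eq_card => y; rewrite !inE (pairingC du).
rewrite (eqc s) (eqc t); apply: (aux t s (disjoint_uniqC du)) => y Py.
by rewrite -(pairingC du); apply: cl.
Qed.

(** The two lists have equally many moved elements, and a list that is not the longer one has no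
    fixed element. *)
Lemma card_pairing_fix s t : disjoint_uniq s t ->
  #|[pred y | (y \in s) && (pairing s t y == y)]| = size s - size t.
Proof.
move=> du; have [us ut d] := du.
have split s' (us' : uniq s') : size s' =
    #|[pred y | (y \in s') && (pairing s t y == y)]|
    + #|[pred y | [&& y \in s', true & pairing s t y != y]]|.
  rewrite -(card_uniqP us') -(cardID [pred y | pairing s t y == y]).
  congr (_ + _); apply: eq_card => y; rewrite !inE //=.
  by rewrite andbC.
have := card_pairing du (P := xpredT) (fun _ _ => isT).
have := split s us; have := split t ut.
have [le|gt] := leqP (size s) (size t).
  move=> _ _ _; have -> : size s - size t = 0 by lia.
  apply: eq_card0 => y; rewrite !inE; apply/negP => /andP[ys].
  by rewrite (negbTE (pairing_move du le ys)).
have -> : #|[pred y | (y \in t) && (pairing s t y == y)]| = 0.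
  apply: eq_card0 => y; rewrite !inE; apply/negP => /andP[yt].
  by rewrite (pairingC du) (negbTE (pairing_move (disjoint_uniqC du) (ltnW gt) yt)).
lia.
Qed.

End Pairing.

(** * Trails in two colours *)

Lemma card_split (T : finType) (P Q : pred T) :
  #|[pred y | P y]| = #|[pred y | P y & Q y]| + #|[pred y | P y & ~~ Q y]|.
Proof.
rewrite -(cardID [pred y | Q y]); congr (_ + _); apply: eq_card => y.
by rewrite !inE andbC.
Qed.

Section Counting.

Variables (T C : finType).
Implicit Types (h : rel T) (f g : T -> T -> C) (X Y : {set T * T}).

Definition cdeg h f i u := #|[pred y | h u y & f u y == i]|.

(** The elements of [X] are darts: [(x, y)] stands for the edge xy seen from its end x. *)
Definition num_ends f X i u := #|[set z in X | (z.1 == u) && (f z.1 z.2 == i)]|.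

Definition swaps h i j f g := forall x y, g x y != f x y ->
  [&& h x y, (f x y == i) || (f x y == j) & (g x y == i) || (g x y == j)].

Lemma cdeg_swaps h h' f g i j c u : swaps h i j f g -> c != i -> c != j ->
  cdeg h' g c u = cdeg h' f c u.
Proof.
move=> sw ci cj; apply: eq_card => y; rewrite !inE; congr andb.
have [->//|/sw/and3P[_ fij gij]] := eqVneq (g u y) (f u y).
have ne k : (k == i) || (k == j) -> k == c = false.
  by case/orP => /eqP->; rewrite eq_sym; apply/negbTE.
by rewrite !ne.
Qed.

Lemma num_ends1 f z i u : num_ends f [set z] i u = (z.1 == u) && (f z.1 z.2 == i).
Proof.
rewrite /num_ends; case: (boolP ((z.1 == u) && (f z.1 z.2 == i))) => c.
  rewrite -[RHS](cards1 z); apply: eq_card => t; rewrite !inE.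
  by case: (t =P z) => //= ->.
by apply: eq_card0 => t; rewrite !inE; case: (t =P z) => //= ->; apply/negbTE.
Qed.

Lemma num_endsU f X Y i u : [disjoint X & Y] ->
  num_ends f (X :|: Y) i u = num_ends f X i u + num_ends f Y i u.
Proof.
move=> d; rewrite /num_ends -cardsUI [X in _ + X]eq_card0 ?addn0.
  by apply: eq_card => z; rewrite !inE andb_orl.
move=> z; rewrite !inE andbACA; case: (boolP (z \in X)) => //= zX.
by rewrite (disjointFr d zX).
Qed.

Lemma leq_num_ends f X Y i u : X \subset Y -> num_ends f X i u <= num_ends f Y i u.
Proof.
move=> XY; apply: subset_leq_card; apply/subsetP => z; rewrite !inE.
by case/andP => /(subsetP XY) ->.
Qed.

Lemma num_endsE f X i u : num_ends f X i u = #|[pred y | (u, y) \in X & f u y == i]|.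
Proof.
have inj : injective (pair u : T -> T * T) by move=> y y' [].
rewrite /num_ends -(card_image inj); apply: eq_card => -[x y]; rewrite !inE /=.
apply/and3P/imageP => [[zX /eqP xu fz]|[y' + [-> ->]]].
  by subst x; exists y; rewrite // inE zX.
by rewrite inE => /andP[-> ->].
Qed.

End Counting.

Section Trails.

Variables (T C : finType) (h : rel T) (f : T -> T -> C) (a b : C) (v : T).
Hypotheses (h_sym : symmetric h) (h_irr : irreflexive h).
Hypotheses (f_sym : forall x y, f x y = f y x) (ab : a != b).

(** On darts, [rev] crosses an edge, while [pi] below passes at a vertex from an edge of one of the
    two colours to its partner in the other. The walks of the two involutions are thus alternating
    trails. *)
Let rev (z : T * T) := (z.2, z.1).

(* Nothing is paired at [v], so every trail reaching [v] ends there. *)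
Let edges i u := if u == v then [::] else [seq y <- enum T | h u y & f u y == i].

Let pr u := pairing (edges a u) (edges b u).

Let pi (z : T * T) := (z.1, pr z.1 z.2).

Let act (z : T * T) := h z.1 z.2 && ((f z.1 z.2 == a) || (f z.1 z.2 == b)).

(** The unpaired darts of the two colours: the ends of trails. *)
Let E := [set z | act z & pi z == z].

Let revK : involutive rev. Proof. by case. Qed.

Let mem_edges i u y : (y \in edges i u) = [&& u != v, h u y & f u y == i].
Proof. by rewrite /edges; case: eqP => //=; rewrite mem_filter mem_enum andbT. Qed.

Let edges_du u : disjoint_uniq (edges a u) (edges b u).
Proof.
split; try by rewrite /edges; case: eqP => //; rewrite filter_uniq ?enum_uniq.
move=> y; rewrite !mem_edges => /and3P[_ _ /eqP ->].
by rewrite (negbTE ab) !andbF.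
Qed.

Let piK : involutive pi.
Proof. by case=> x y; rewrite /pi /pr /= (pairingK (edges_du x)). Qed.

Let act_rev z : act z -> act (rev z).
Proof. by rewrite /act /= h_sym f_sym. Qed.

Let act_pi z : act z -> act (pi z).
Proof.
case: z => u y aux; rewrite /pi /=; have [->//|ne] := eqVneq (pr u y) y.
have := aux; rewrite /act /= => /andP[huy fuy].
have [uv|uv] := eqVneq u v.
  by move: ne; rewrite /pr /edges uv eqxx /pairing /= eqxx.
have [fa|fa] := boolP (f u y == a).
  have /pairing_mem/(_ ne) : y \in edges a u by rewrite mem_edges uv huy.
  by rewrite mem_edges => /and3P[_ -> ->]; rewrite orbT.
rewrite (negbTE fa) /= in fuy.
have yb : y \in edges b u by rewrite mem_edges uv huy.
move: ne; rewrite /pr (pairingC (edges_du u)) => /(pairing_mem yb).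
by rewrite mem_edges => /and3P[_ -> ->].
Qed.

Let act_walk x z : act x -> walk rev pi x z -> act z.
Proof.
move=> ax /iter_findex <-; elim: (findex _ _ _) => //= n IHn.
exact/act_rev/act_pi.
Qed.

Let act_free z : act z -> rev z <> z.
Proof. by case: z => x y /andP[hxy _] [E1]; move: hxy; rewrite /= E1 h_irr. Qed.

Let mt := mate rev pi.

Let E_free x : x \in E -> forall z, walk rev pi x z -> rev z <> z.
Proof. by rewrite inE => /andP[ax _] z /(act_walk ax)/act_free. Qed.

Let E_fix x : x \in E -> pi x = x.
Proof. by rewrite inE => /andP[_ /eqP]. Qed.

Let mateE x : x \in E -> [/\ mt x \in E, mt x != x & mt (mt x) = x].
Proof.
move=> xE; have xf := E_fix xE; have fr := E_free xE; split.
- rewrite inE (mate_fix revK piK xf fr) eqxx andbT.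
  move: xE; rewrite inE => /andP[ax _].
  by apply: act_walk ax _; apply: mate_walk.
- by apply/eqP; apply: mate_neq.
- exact: mateK.
Qed.

(** Pairing at [u] leaves over exactly the surplus of the commoner colour. *)
Let endsE u : u != v ->
  num_ends f E a u = cdeg h f a u - cdeg h f b u /\
  num_ends f E b u = cdeg h f b u - cdeg h f a u.
Proof.
move=> uv; have du := edges_du u.
have sz i : size (edges i u) = cdeg h f i u.
  have us : uniq (edges i u) by rewrite /edges (negbTE uv) filter_uniq ?enum_uniq.
  by rewrite -(card_uniqP us); apply: eq_card => y; rewrite mem_edges uv.
have ends i : (i == a) || (i == b) -> num_ends f E i u
    = #|[pred y | (y \in edges i u) && (pairing (edges a u) (edges b u) y == y)]|.
  move=> iab; rewrite num_endsE; apply: eq_card => y.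
  rewrite !inE mem_edges uv /act /pi /= xpair_eqE eqxx /=.
  case: (f u y =P i) => [->|_]; last by rewrite !andbF.
  by rewrite iab !andbT.
rewrite !ends ?eqxx ?orbT //; split.
  by rewrite (card_pairing_fix du) !sz.
rewrite -!sz -(card_pairing_fix (disjoint_uniqC du)).
by apply: eq_card => y; rewrite !inE (pairingC du).
Qed.

Section Flip.

Variable X : {set T * T}.
Hypotheses (XE : X \subset E) (X_mate : forall z, z \in X -> mt z \in X).

Let F := [set z | [exists x in X, walk rev pi x z]].

Let F_act z : z \in F -> act z.
Proof.
rewrite inE => /exists_inP[x xX]; apply: act_walk.
by have := subsetP XE _ xX; rewrite inE => /andP[].
Qed.

Let F_rev z : (rev z \in F) = (z \in F).
Proof.
have aux z' : z' \in F -> rev z' \in F.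
  rewrite !inE => /exists_inP[x xX xz]; apply/exists_inP; exists x => //.
  by apply: walk_rev xz => //; apply: E_fix; apply: (subsetP XE).
by apply/idP/idP => [/aux|]; [rewrite revK | apply: aux].
Qed.

Let F_pi z : z \in F -> pi z \in F.
Proof.
rewrite !inE => /exists_inP[x xX xz]; apply/exists_inP; exists x => //.
by apply: walk_pi xz => //; apply: E_fix; apply: (subsetP XE).
Qed.

Let F_fix z : (z \in F) && (pi z == z) = (z \in X).
Proof.
apply/andP/idP => [[] | zX].
  rewrite inE => /exists_inP[x xX xz] /eqP zf.
  have xE := subsetP XE _ xX.
  have [->|->] := walk_fix revK piK (E_fix xE) (E_free xE) xz zf => //.
  exact: X_mate.
split; last by rewrite E_fix ?(subsetP XE).
by rewrite inE; apply/exists_inP; exists z => //; apply: connect0.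
Qed.

Let g x y := if (x, y) \in F then (if f x y == a then b else a) else f x y.

(** [pr u] matches the paired darts of [F] at [u], so exchanging the colours on them changes no
    colour degree. Only the unpaired darts of [F] count, and those form [X]. *)
Let moved u :
  #|[pred y | [&& (u, y) \in F, pr u y != y & f u y == a]]|
  = #|[pred y | [&& (u, y) \in F, pr u y != y & f u y == b]]|.
Proof.
have [uv|uv] := eqVneq u v.
  have prv y : pr u y != y = false.
    by rewrite /pr /edges uv eqxx /pairing /= eqxx.
  by rewrite !eq_card0 // => y; rewrite !inE prv !andbF.
have toE i : #|[pred y | [&& (u, y) \in F, pr u y != y & f u y == i]]|
    = #|[pred y | [&& y \in edges i u, (u, y) \in F & pr u y != y]]|.
  apply: eq_card => y; rewrite inE [RHS]inE mem_edges uv /=.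
  case: (boolP ((u, y) \in F)) => [/F_act/andP[/= -> _]|]; last by rewrite !andbF.
  by rewrite andbC.
rewrite !toE; apply: (card_pairing (P := fun y => (u, y) \in F)) => // y.
exact: F_pi.
Qed.

Let in_F i u : #|[pred y | (u, y) \in F & f u y == i]|
  = num_ends f X i u + #|[pred y | [&& (u, y) \in F, pr u y != y & f u y == i]]|.
Proof.
rewrite num_endsE (card_split _ (fun y => pr u y == y)); congr (_ + _).
  apply: eq_card => y; rewrite inE [RHS]inE -F_fix /pi /=.
  by rewrite xpair_eqE eqxx /= -!andbA; congr andb; rewrite andbC.
by apply: eq_card => y; rewrite inE [RHS]inE /= -andbA; congr andb; rewrite andbC.
Qed.

Let split_cdeg (k : T -> T -> C) i u : cdeg h k i u
  = #|[pred y | [&& h u y, (u, y) \notin F & k u y == i]]|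
    + #|[pred y | (u, y) \in F & k u y == i]|.
Proof.
rewrite addnC /cdeg (card_split _ (fun y => (u, y) \in F)); congr (_ + _).
  apply: eq_card => y; rewrite inE [RHS]inE /=.
  case: (boolP ((u, y) \in F)) => [/F_act/andP[/= -> _]|]; last by rewrite !andbF.
  by rewrite andbT.
apply: eq_card => y; rewrite inE [RHS]inE /= -andbA; congr andb.
by rewrite andbC.
Qed.

Let outside i u : #|[pred y | [&& h u y, (u, y) \notin F & g u y == i]]|
  = #|[pred y | [&& h u y, (u, y) \notin F & f u y == i]]|.
Proof.
apply: eq_card => y; rewrite inE [RHS]inE /g.
by case: (boolP ((u, y) \in F)) => //; rewrite !andbF.
Qed.

Let swap_a u : #|[pred y | (u, y) \in F & g u y == a]|
  = #|[pred y | (u, y) \in F & f u y == b]|.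
Proof.
apply: eq_card => y; rewrite inE [RHS]inE /g.
case: (boolP ((u, y) \in F)) => //= /F_act/andP[/= _].
case: eqP => [->|_ /= ->] //=; last by rewrite eqxx.
Qed.

Let swap_b u : #|[pred y | (u, y) \in F & g u y == b]|
  = #|[pred y | (u, y) \in F & f u y == a]|.
Proof.
apply: eq_card => y; rewrite inE [RHS]inE /g.
case: (boolP ((u, y) \in F)) => //= /F_act/andP[/= _].
by case: eqP => [->|_ /= _] //=; rewrite ?eqxx // (negbTE ab).
Qed.

Lemma flip_spec : exists k : T -> T -> C, [/\ forall x y, k x y = k y x,
  swaps h a b f k,
  forall u, cdeg h k a u + num_ends f X a u = cdeg h f a u + num_ends f X b u,
  forall u, cdeg h k b u + num_ends f X b u = cdeg h f b u + num_ends f X a u &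
  forall y, (v, y) \in E -> (v, y) \notin X -> k v y = f v y].
Proof.
exists g; split.
- by move=> x y; rewrite /g f_sym -[(x, y) \in F]F_rev.
- move=> x y; rewrite /g; case: ifP => [/F_act/andP[-> ->] _|]; last by rewrite eqxx.
  by rewrite /=; case: ifP; rewrite eqxx ?orbT.
- move=> u; rewrite !split_cdeg outside swap_a !in_F moved; lia.
- move=> u; rewrite !split_cdeg outside swap_b !in_F moved; lia.
- move=> y /E_fix yf yX; rewrite /g; case: ifP => // yF.
  by move: yX; rewrite -F_fix yF yf eqxx.
Qed.

End Flip.

Lemma trails : exists (E : {set T * T}) (mt : T * T -> T * T), [/\
  forall z, z \in E -> h z.1 z.2 && ((f z.1 z.2 == a) || (f z.1 z.2 == b)),
  forall z, z \in E -> [/\ mt z \in E, mt z != z & mt (mt z) = z],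
  forall y, h v y -> (f v y == a) || (f v y == b) -> (v, y) \in E,
  forall u, u != v -> num_ends f E a u = cdeg h f a u - cdeg h f b u /\
                      num_ends f E b u = cdeg h f b u - cdeg h f a u &
  forall X : {set T * T}, X \subset E -> (forall z, z \in X -> mt z \in X) ->
  exists k : T -> T -> C, [/\ forall x y, k x y = k y x,
    swaps h a b f k,
    forall u, cdeg h k a u + num_ends f X a u = cdeg h f a u + num_ends f X b u,
    forall u, cdeg h k b u + num_ends f X b u = cdeg h f b u + num_ends f X a u &
    forall y, (v, y) \in E -> (v, y) \notin X -> k v y = f v y]].
Proof.
exists E, mt; split=> //.
- by move=> z; rewrite inE => /andP[].
- move=> y hvy fab; rewrite inE /act /= hvy fab /=.
  by rewrite /pi /pr /edges eqxx /pairing.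
- by move=> X XE Xm; apply: flip_spec.
Qed.

End Trails.

Section TrailSystem.

Variables (T C : finType) (h : rel T) (f : T -> T -> C) (a b : C) (v : T).

Definition squares (k : T -> T -> C) u :=
  cdeg h k a u * cdeg h k a u + cdeg h k b u * cdeg h k b u.

Definition tip (z : T * T) i u := (z.1 == u) && (f z.1 z.2 == i).

Hypotheses (h_sym : symmetric h) (h_irr : irreflexive h).
Hypotheses (f_sym : forall x y, f x y = f y x) (ab : a != b).

(* [E] is the set of trail ends and [mt] exchanges the two ends of a trail; [k] arises
   from [f] by exchanging [a] and [b] along the trails ending in [x] (and in [z]). *)
Lemma trail_flips : exists (E : {set T * T}) (mt : T * T -> T * T), [/\
  forall z, z \in E -> (f z.1 z.2 == a) || (f z.1 z.2 == b),
  forall z, z \in E -> [/\ mt z \in E, mt z != z & mt (mt z) = z],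
  forall i u, (i == a) || (i == b) -> 
    #|[set z in E | tip z i u]|
      = cdeg h f i u - (if u == v then 0 else cdeg h f (if i == a then b else a) u),
  forall x, x \in E -> exists k : T -> T -> C, [/\ forall x y, k x y = k y x,
    swaps h a b f k,
    forall u, cdeg h k a u + (tip x a u + tip (mt x) a u)
            = cdeg h f a u + (tip x b u + tip (mt x) b u) /\
              cdeg h k b u + (tip x b u + tip (mt x) b u)
            = cdeg h f b u + (tip x a u + tip (mt x) a u),
    forall u, u != v -> squares k u <= squares f u &
    forall y, (v, y) != x -> (v, y) != mt x -> f v y = b -> k v y = b] &
  forall x z, x \in E -> z \in E -> z != x -> z != mt x ->
  exists k : T -> T -> C, [/\ forall x y, k x y = k y x,
    swaps h a b f k,
    forall u, cdeg h k a u + (tip x a u + tip (mt x) a u + (tip z a u + tip (mt z) a u))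
            = cdeg h f a u + (tip x b u + tip (mt x) b u + (tip z b u + tip (mt z) b u)) /\
              cdeg h k b u + (tip x b u + tip (mt x) b u + (tip z b u + tip (mt z) b u))
            = cdeg h f b u + (tip x a u + tip (mt x) a u + (tip z a u + tip (mt z) a u)),
    forall u, u != v -> squares k u <= squares f u &
    forall y, (v, y) != x -> (v, y) != mt x -> (v, y) != z -> (v, y) != mt z ->
      f v y = b -> k v y = b]].
Proof.
have [E [mt [EP mtP Ev Eu flip]]] := trails v h_sym h_irr f_sym ab.
have pairE x i u : x \in E ->
    num_ends f [set x; mt x] i u = tip x i u + tip (mt x) i u.
  move=> xE; have [_ ne _] := mtP x xE; rewrite num_endsU ?num_ends1 //.
  by rewrite disjoints1 inE eq_sym.
have pair_sub x : x \in E -> [set x; mt x] \subset E.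
  by move=> xE; have [mE _ _] := mtP x xE; rewrite subUset !sub1set xE.
have pair_cl x : x \in E -> forall z, z \in [set x; mt x] -> mt z \in [set x; mt x].
  move=> xE z; have [_ _ mK] := mtP x xE.
  by rewrite !inE => /orP[]/eqP->; rewrite ?mK eqxx ?orbT.
(* All trail ends at [u] have the commoner colour and their number is its surplus. After flipping
   some of them both degrees are still at least the old minimum, with the same sum. *)
have noninc (X : {set T * T}) (k : T -> T -> C) : X \subset E ->
    (forall u, cdeg h k a u + num_ends f X a u = cdeg h f a u + num_ends f X b u) ->
    (forall u, cdeg h k b u + num_ends f X b u = cdeg h f b u + num_ends f X a u) ->
    forall u, u != v -> squares k u <= squares f u.
  move=> XE ha hb u uv; have [ea eb] := Eu u uv; rewrite /squares.
  have := leq_num_ends f a u XE; have := leq_num_ends f b u XE.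
  rewrite ea eb; have := ha u; have := hb u.
  move: (num_ends f X a u) (num_ends f X b u) (cdeg h f a u) (cdeg h f b u)
        (cdeg h k a u) (cdeg h k b u) => p q x y x' y'.
  case: (leqP x y) => c e1 e2 le1 le2.
    have p0 : p = 0 by lia.
    have [r yE] : exists r, y = x + q + r by exists (y - x - q); lia.
    have -> : x' = x + q by lia.
    have -> : y' = x + r by lia.
    by rewrite yE; nia.
  have q0 : q = 0 by lia.
  have [r yE] : exists r, x = y + p + r by exists (x - y - p); lia.
  have -> : x' = y + r by lia.
  have -> : y' = y + p by lia.
  by rewrite yE; nia.
(* As nothing is paired at [v], a [b]-edge there is a trail end and changes colour only if its dart
   is in [X]. *)
have protect (X : {set T * T}) (k : T -> T -> C) y : swaps h a b f k ->
    (forall y, (v, y) \in E -> (v, y) \notin X -> k v y = f v y) ->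
    (v, y) \notin X -> f v y = b -> k v y = b.
  move=> sw pr yX fb; have [->//|/sw/and3P[hvy _ _]] := eqVneq (k v y) (f v y).
  by rewrite pr // Ev // fb eqxx orbT.
exists E, mt; split=> //.
- by move=> z /EP/andP[].
- move=> i u iab; have [->|uv] := eqVneq u v.
    rewrite subn0 -[LHS]/(num_ends f E i v) num_endsE; apply: eq_card => y.
    rewrite !inE; case: (boolP ((v, y) \in E)) => [/EP/andP[/= -> _]//|].
    case: (boolP (h v y)) => //= hvy; case: (f v y =P i) => // fi.
    by rewrite Ev // fi.
  have [ea eb] := Eu u uv; case/orP: iab => /eqP->; rewrite ?eqxx //.
  by rewrite eq_sym (negbTE ab).
- move=> x xE.
  have [k [k_sym sw ka kb pr]] := flip _ (pair_sub x xE) (pair_cl x xE).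
  exists k; split=> //.
  + by move=> u; have := ka u; have := kb u; rewrite !pairE.
  + exact: noninc (pair_sub x xE) ka kb.
  + by move=> y yx ym; apply: protect sw pr _; rewrite !inE negb_or yx.
- move=> x z xE zE zx zm; have [mxE _ mxK] := mtP x xE; have [_ _ mzK] := mtP z zE.
  have dj : [disjoint [set x; mt x] & [set z; mt z]].
    rewrite -setI_eq0; apply/eqP/setP => t; rewrite !inE.
    apply/negbTE/negP => /andP[/orP[]/eqP-> /orP[]/eqP E1]; move: zx zm.
    + by rewrite E1 eqxx.
    + by rewrite E1 mzK eqxx.
    + by rewrite E1 eqxx.
    + by rewrite -mxK E1 mzK eqxx.
  have sub : [set x; mt x] :|: [set z; mt z] \subset E.
    by rewrite subUset !pair_sub.
  have cl t : t \in [set x; mt x] :|: [set z; mt z] ->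
      mt t \in [set x; mt x] :|: [set z; mt z].
    by rewrite in_setU [in X in _ -> X]in_setU => /orP[tx|tz]; apply/orP; [left | right]; apply: pair_cl.
  have [k [k_sym sw ka kb pr]] := flip _ sub cl.
  exists k; split=> //.
  + by move=> u; have := ka u; have := kb u; rewrite !(num_endsU _ _ _ dj) !pairE.
  + exact: noninc sub ka kb.
  + move=> y y1 y2 y3 y4; apply: protect sw pr _.
    by rewrite !inE !negb_or y1 y2 y3.
Qed.

End TrailSystem.

(** [m] is injective on [P], so the image of [P] is too large to fit into [S]. *)
Lemma involution_escape (D : finType) (m : D -> D) (P S : {set D}) :
    (forall z, z \in P -> m (m z) = z) -> #|S| < #|P| ->
  exists2 z, z \in P & m z \notin S.
Proof.
move=> mK lt; apply/exists_inP; apply: contraTT lt => /exists_inPn none.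
rewrite -leqNgt -(card_in_imset (can_in_inj mK)) subset_leq_card //.
by apply/subsetP => _ /imsetP[z zP ->]; have := none z zP; rewrite negbK.
Qed.

(** * Correcting a deficit at one vertex by flipping one or two trails *)

Section Exchange.

Variables (T C : finType) (h : rel T) (f : T -> T -> C) (a b : C) (v w y0 : T).
Hypotheses (h_sym : symmetric h) (h_irr : irreflexive h).
Hypotheses (f_sym : forall x y, f x y = f y x) (ab : a != b) (vw : v != w).
Hypothesis v_many : cdeg h f b v <= cdeg h f a v.
Hypothesis w_few : cdeg h f a w + 2 <= cdeg h f b w.

(** Meant for a graph from which the edge [v w] has been deleted; giving that edge a suitable colour
    afterwards completes the change. In the second alternative only [v] and [w] change degrees, and
    a [b]-edge from [v] to [y0] survives. *)
Lemma exchange : exists g : T -> T -> C,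
  [/\ forall x y, g x y = g y x, swaps h a b f g &
  [/\ cdeg h g a v = cdeg h f a v, cdeg h g b v = cdeg h f b v,
      cdeg h g a w = cdeg h f a w + 1, cdeg h g b w + 1 = cdeg h f b w &
      forall u, u != v -> squares h a b g u <= squares h a b f u]
  \/ [/\ f v y0 = b -> g v y0 = b,
      forall i u, u != v -> u != w -> cdeg h g i u = cdeg h f i u &
      [/\ cdeg h g a v = cdeg h f a v, cdeg h g b v = cdeg h f b v,
          cdeg h g a w = cdeg h f a w + 2 & cdeg h g b w + 2 = cdeg h f b w]
      \/ [/\ cdeg h g a v + 1 = cdeg h f a v, cdeg h g b v = cdeg h f b v + 1,
          cdeg h g a w = cdeg h f a w + 1 & cdeg h g b w + 1 = cdeg h f b w]]].
Proof.
have [E [mt [EP mtP cardE flip2 flip4]]] := trail_flips v h_sym h_irr f_sym ab.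
have wv : w == v = false by rewrite eq_sym (negbTE vw).
have vwF := negbTE vw; have abF := negbTE ab.
have baF : b == a = false by rewrite eq_sym.
have others (g : T -> T -> C) : swaps h a b f g ->
    (forall u, u != v -> u != w -> cdeg h g a u = cdeg h f a u /\ cdeg h g b u = cdeg h f b u) ->
    forall i u, u != v -> u != w -> cdeg h g i u = cdeg h f i u.
  move=> sw e i u uv uw; have [ea eb] := e u uv uw.
  have [->//|ia] := eqVneq i a; have [->//|ib] := eqVneq i b.
  exact: cdeg_swaps sw ia ib.
(* At [w] colour [a] is the rarer one, so no trail ends there in colour [a]. *)
have no_a z : z \in E -> z.1 = w -> f z.1 z.2 = b.
  move=> zE zw; case/orP: (EP z zE) => /eqP // fz.
  have := cardE a w; rewrite eqxx wv => /(_ isT).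
  have -> : cdeg h f a w - cdeg h f b w = 0 by lia.
  by move/eqP; rewrite cards_eq0 => /eqP/setP/(_ z); rewrite !inE zE /tip fz zw !eqxx.
pose Ew := [set z in E | tip f z b w].
have EwE : 1 < #|Ew|.
  by rewrite /Ew cardE ?eqxx ?orbT // wv baF; lia.
(* If some trail from [w] does not end in a [b]-edge at [v], flipping it alone suffices, and the
   place of its other end decides between the alternatives. *)
case: (boolP [forall x in Ew, tip f (mt x) b v]) => [/forall_inP all_v|]; last first.
  case/forall_inPn => x; rewrite inE => /andP[xE /andP[/eqP x1 /eqP fx]] mx.
  have [mE _ mK] := mtP x xE; have [k [k_sym sw eab noninc prot]] := flip2 x xE.
  exists k; split=> //.
  have [mv|mv] := eqVneq (mt x).1 v.
    have fm : f (mt x).1 (mt x).2 = a.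
      by case/orP: (EP _ mE) => /eqP // fm; case/negP: mx; rewrite /tip fm mv ?eqxx.
    right; split.
    - move=> fv; apply: prot (fv).
        by apply: contraNneq vw => E1; rewrite -x1 -E1.
      by apply: contraNneq ab => E1; rewrite -fm -E1 /= fv.
    - apply: others sw _ => u /negbTE uv /negbTE uw; case: (eab u).
      by rewrite /tip fx x1 fm mv ![_ == u]eq_sym ?uv ?uw /=; clear; split; lia.
    - right; have [va vb] := eab v; have [wa wb] := eab w; move: va vb wa wb.
      by rewrite /tip fx x1 fm mv ?eqxx ?vwF ?wv ?abF ?baF /=; clear; split; lia.
  have [mw|mw] := eqVneq (mt x).1 w.
    have fm := no_a _ mE mw; right; split.
    - apply: prot; first by apply: contraNneq vw => E1; rewrite -x1 -E1.
      by apply: contraNneq vw => E1; rewrite -mw -E1.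
    - apply: others sw _ => u /negbTE uv /negbTE uw; case: (eab u).
      by rewrite /tip fx x1 fm mw ![_ == u]eq_sym uw /=; clear; split; lia.
    - left; have [va vb] := eab v; have [wa wb] := eab w; move: va vb wa wb.
      by rewrite /tip fx x1 fm mw ?eqxx ?wv ?abF ?baF /=; clear; split; lia.
  left; have [va vb] := eab v; have [wa wb] := eab w; move: va vb wa wb.
  rewrite /tip fx x1 (negbTE mv) (negbTE mw) ?eqxx ?wv ?abF ?baF /= => va vb wa wb.
  by split=> //; clear -va vb wa wb; lia.
(* Now all trails from [w] end in [b]-edges at [v]. There are at least two, so one of them avoids
   the dart [(v, y0)]. *)
have [x xEw xy] : exists2 x, x \in Ew & mt x \notin [set (v, y0)].
  apply: involution_escape; last by rewrite cards1.
  by move=> z; rewrite inE => /andP[/mtP[]].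
have mx := all_v x xEw; rewrite !inE in xy.
move: xEw; rewrite inE => /andP[xE /andP[/eqP x1 /eqP fx]].
have [mE _ mK] := mtP x xE; case/andP: mx => /eqP mx1 /eqP fmx.
(* Flipping [x] alone would raise the [a]-degree at [v]; a second trail compensates. By [v_many] the
   [a]-ends at [v] outnumber the [b]-ends other than [mt x], so one of them leads elsewhere. *)
have [z] : exists2 z, z \in [set z in E | tip f z a v]
    & mt z \notin [set z in E | tip f z b v] :\ mt x.
  apply: involution_escape.
    by move=> z; rewrite inE => /andP[/mtP[]].
  have mxB : mt x \in [set z in E | tip f z b v] by rewrite inE mE /tip fmx mx1 !eqxx.
  have := cardsD1 (mt x) [set z in E | tip f z b v]; rewrite mxB.
  by rewrite !cardE ?eqxx ?orbT //= !subn0 => E1; apply: leq_trans v_many; rewrite E1.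
rewrite inE => /andP[zE /andP[/eqP z1 /eqP fz]].
have [mzE _ mzK] := mtP z zE; rewrite !inE mzE negb_and negbK => mz.
have zx : z != x by apply: contraNneq vw => E1; rewrite -z1 E1 x1.
have zmx : z != mt x by apply: contraNneq ab => E1; rewrite -fz E1 fmx.
have {}mz : ~~ tip f (mt z) b v.
  case/orP: mz => // /eqP E1; case/negP: zx; apply/eqP.
  by rewrite -mzK E1 mK.
have mzw : (mt z).1 != w.
  apply/eqP => E1; have := all_v (mt z).
  rewrite inE mzE /tip (no_a _ mzE E1) E1 !eqxx mzK fz z1 (negbTE ab) andbF.
  by move/(_ isT).
have [k [k_sym sw eab noninc prot]] := flip4 x z xE zE zx zmx.
exists k; split=> //.
have [mv|mv] := eqVneq (mt z).1 v; last first.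
  left; have [va vb] := eab v; have [wa wb] := eab w; move: va vb wa wb.
  rewrite /tip fx x1 fmx mx1 fz z1 (negbTE mv) (negbTE mzw) ?eqxx ?wv ?vwF ?abF ?baF /= => va vb wa wb.
  by split=> //; clear -va vb wa wb; lia.
have fm : f (mt z).1 (mt z).2 = a.
  by case/orP: (EP _ mzE) => /eqP // fm; case/negP: mz; rewrite /tip fm mv ?eqxx.
right; split.
- move=> fv; apply: prot (fv).
  + by apply: contraNneq vw => E1; rewrite -x1 -E1.
  + by rewrite eq_sym.
  + by apply: contraNneq ab => E1; rewrite -fz -E1 /= fv.
  + by apply: contraNneq ab => E1; rewrite -fm -E1 /= fv.
- apply: others sw _ => u /negbTE uv /negbTE uw; case: (eab u).
  by rewrite /tip fx x1 fmx mx1 fz z1 fm mv ![_ == u]eq_sym ?uv ?uw /=; clear; split; lia.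
- right; have [va vb] := eab v; have [wa wb] := eab w; move: va vb wa wb.
  by rewrite /tip fx x1 fmx mx1 fz z1 fm mv ?eqxx ?wv ?vwF ?abF ?baF /=; clear; split; lia.
Qed.

End Exchange.

(** * Optimal colourings *)

(** Convexity: a pair with the same sum whose entries are at least the old minimum is no more spread
    out. *)
Lemma squares_spread x y x' y' : x' + y' = x + y -> minn x y <= x' -> minn x y <= y' ->
  x' * x' + y' * y' <= x * x + y * y.
Proof.
wlog le : x y / x <= y => [hw|]; last first.
  rewrite (minn_idPl le) => E1 l1 l2.
  have [p Ep] : exists p, x' = x + p by exists (x' - x); lia.
  have [q Eq] : exists q, y' = x + q by exists (y' - x); lia.
  have -> : y = x + p + q by lia.
  by rewrite Ep Eq !mulnDl !mulnDr; lia.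
case: (leqP x y) => c E1 l1 l2; first by apply: hw; rewrite // (minn_idPl c).
by rewrite [X in _ <= X]addnC; apply: hw; rewrite ?(ltnW c) // ?(minn_idPl (ltnW c)) //; lia.
Qed.

Section Potential.

Variables (T C : finType) (e : rel T).
Hypotheses (e_sym : symmetric e) (e_irr : irreflexive e).
Implicit Types (f g k : T -> T -> C) (a b c i : C) (u v w : T).

Definition weight f u := \sum_i cdeg e f i u * cdeg e f i u.

Definition potential f := \sum_u weight f u.

Definition optimal f := (forall x y, f x y = f y x) /\
  forall g, (forall x y, g x y = g y x) -> potential f <= potential g.

Lemma weight_two f k a b u : a != b ->
    (forall i, i != a -> i != b -> cdeg e k i u = cdeg e f i u) ->
  weight k u + squares e a b f u = weight f u + squares e a b k u.
Proof.
move=> ab same; have ba : b != a by rewrite eq_sym.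
rewrite /weight /squares.
rewrite (bigD1 a) // (bigD1 b) //= [in RHS](bigD1 a) // [in RHS](bigD1 b) //=.
rewrite (eq_bigr (fun i => cdeg e f i u * cdeg e f i u)); first by lia.
by move=> i /andP[ia ib]; rewrite same.
Qed.

Lemma weight_swaps h f k a b u : a != b -> swaps h a b f k ->
  weight k u + squares e a b f u = weight f u + squares e a b k u.
Proof. by move=> ab sw; apply: weight_two => // i; apply: cdeg_swaps sw. Qed.

(** Stated with sums on both sides to avoid truncated subtraction; it reduces comparing potentials
    to the vertices [v] and [w]. *)
Lemma potential2 f k v w : v != w ->
    (forall u, u != v -> u != w -> weight k u <= weight f u) ->
  potential k + (weight f v + weight f w) <= potential f + (weight k v + weight k w).
Proof.
move=> vw le; have wv : w != v by rewrite eq_sym.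
rewrite /potential (bigD1 v) // (bigD1 w) //= [in X in _ <= X](bigD1 v) //.
rewrite [in X in _ <= X](bigD1 w) //=.
have : \sum_(i | (i != v) && (i != w)) weight k i
    <= \sum_(i | (i != v) && (i != w)) weight f i.
  by apply: leq_sum => i /andP[iv iw]; apply: le.
lia.
Qed.

Lemma optimal_min f k v w : optimal f -> (forall x y, k x y = k y x) -> v != w ->
    (forall u, u != v -> u != w -> weight k u <= weight f u) ->
  weight f v + weight f w <= weight k v + weight k w.
Proof.
move=> [_ fmin] k_sym vw le; have := potential2 vw le; have := fmin k k_sym; lia.
Qed.

Lemma optimal_le f k : optimal f -> (forall x y, k x y = k y x) ->
  potential k <= potential f -> optimal k.
Proof.
move=> [_ fmin] k_sym le; split=> // g g_sym; exact: leq_trans le (fmin g g_sym).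
Qed.

Lemma optimal_eq f k v w : optimal f -> (forall x y, k x y = k y x) -> v != w ->
    (forall u, u != v -> u != w -> weight k u <= weight f u) ->
    weight k v + weight k w <= weight f v + weight f w ->
  optimal k.
Proof.
move=> opt k_sym vw le le2; apply: optimal_le opt k_sym _.
have := potential2 vw le; lia.
Qed.

Definition remove_edge v w : rel T :=
  fun x y => [&& e x y, (x, y) != (v, w) & (x, y) != (w, v)].

Definition recolour f v w c x y :=
  if ((x, y) == (v, w)) || ((x, y) == (w, v)) then c else f x y.

Lemma recolour_sym f v w c : (forall x y, f x y = f y x) ->
  forall x y, recolour f v w c x y = recolour f v w c y x.
Proof.
by move=> f_sym x y; rewrite /recolour !xpair_eqE orbC f_sym (andbC (x == w)) (andbC (x == v)).
Qed.

Lemma remove_edge_sym v w : symmetric (remove_edge v w).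
Proof.
move=> x y; rewrite /remove_edge e_sym !xpair_eqE; congr andb.
by rewrite andbC (andbC (x == w)) (andbC (x == v)).
Qed.

Lemma remove_edge_irr v w : irreflexive (remove_edge v w).
Proof. by move=> x; rewrite /remove_edge e_irr. Qed.

Lemma cdeg_recolour f v w c i u : e v w ->
  cdeg e (recolour f v w c) i u = cdeg (remove_edge v w) f i u + (((u == v) || (u == w)) && (c == i)).
Proof.
move=> evw; have vw : v != w by apply: contraTneq evw => ->; rewrite e_irr.
rewrite /cdeg (card_split _ (fun y => ((u, y) != (v, w)) && ((u, y) != (w, v)))).
congr (_ + _).
  apply: eq_card => y; rewrite !inE /remove_edge /recolour.
  by case: (_ == (v, w)); case: (_ == (w, v)); rewrite /= ?andbF ?andbT.
have single z : e u z -> (forall y, ((u, y) != (v, w)) && ((u, y) != (w, v)) = (y != z)) ->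
    #|[pred y | e u y && (recolour f v w c u y == i) &
        ~~ (((u, y) != (v, w)) && ((u, y) != (w, v)))]| = (c == i).
  move=> euz E1; case: (c =P i) => [ci|ci].
    rewrite -[RHS](card1 z); apply: eq_card => y; rewrite !inE E1 negbK /recolour.
    case: (y =P z) => [->|]; last by rewrite andbF.
    by rewrite euz -[_ || _]negbK negb_or E1 eqxx /= ci eqxx.
  apply: eq_card0 => y; rewrite !inE E1 negbK /recolour -[_ || _]negbK negb_or E1.
  case: (y =P z) => [->|]; last by rewrite andbF.
  by rewrite /= (introF eqP ci) andbF.
have [uv|uv] := eqVneq u v.
  subst u; apply: (single _ evw) => y; rewrite !xpair_eqE eqxx (negbTE vw) /=.
  by rewrite andbT.
have [uw|uw] := eqVneq u w.
  subst u; rewrite e_sym in evw; apply: (single _ evw) => y.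
  by rewrite !xpair_eqE eqxx (eq_sym w) (negbTE vw).
apply: eq_card0 => y; rewrite !inE !xpair_eqE (negbTE uv) (negbTE uw) /=.
by rewrite andbF.
Qed.

Lemma cdeg_remove_edge f v w i u : (forall x y, f x y = f y x) -> e v w ->
  cdeg e f i u = cdeg (remove_edge v w) f i u + (((u == v) || (u == w)) && (f v w == i)).
Proof.
move=> f_sym evw; rewrite -cdeg_recolour //; apply: eq_card => y; rewrite !inE /recolour.
case: ((u, y) =P (v, w)) => [[-> ->]//|_].
case: ((u, y) =P (w, v)) => [[-> ->]|//] /=.
by rewrite [f w v]f_sym.
Qed.

End Potential.

Section Optimal.

Variables (T C : finType) (e : rel T).
Hypotheses (e_sym : symmetric e) (e_irr : irreflexive e).
Implicit Types (f g k : T -> T -> C) (a b c i : C) (u v w : T).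

Lemma edge_neq v w : e v w -> v != w.
Proof. by apply: contraTneq => ->; rewrite e_irr. Qed.

Lemma swaps_recolour f g a c d v w : (forall x y, f x y = f y x) ->
    swaps (remove_edge e v w) a c f g -> e v w -> f v w = a -> (d == a) || (d == c) ->
  swaps e a c f (recolour g v w d).
Proof.
move=> f_sym sw evw fa dac x y; rewrite /recolour.
case: ((x, y) =P (v, w)) => [[-> ->]|_] /=; first by rewrite evw fa eqxx.
case: ((x, y) =P (w, v)) => [[-> ->]|_] /=; first by rewrite e_sym evw f_sym fa eqxx.
by move=> /sw/and3P[/and3P[-> _ _] -> ->].
Qed.

Lemma swaps_refl h f a c : swaps h a c f f.
Proof. by move=> x y; rewrite eqxx. Qed.

Lemma cdeg_recolour_l f v w c i : e v w ->
  cdeg e (recolour f v w c) i v = cdeg (remove_edge e v w) f i v + (c == i).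
Proof. by move=> evw; rewrite cdeg_recolour // eqxx. Qed.

Lemma cdeg_recolour_r f v w c i : e v w ->
  cdeg e (recolour f v w c) i w = cdeg (remove_edge e v w) f i w + (c == i).
Proof. by move=> evw; rewrite cdeg_recolour // eqxx orbT. Qed.

Lemma cdeg_recolour_other f v w c i u : e v w -> u != v -> u != w ->
  cdeg e (recolour f v w c) i u = cdeg (remove_edge e v w) f i u.
Proof. by move=> evw /negbTE uv /negbTE uw; rewrite cdeg_recolour // uv uw addn0. Qed.

Lemma cdeg_remove_l f v w i : (forall x y, f x y = f y x) -> e v w ->
  cdeg e f i v = cdeg (remove_edge e v w) f i v + (f v w == i).
Proof. by move=> f_sym evw; rewrite (cdeg_remove_edge e_sym e_irr _ _ f_sym evw) eqxx. Qed.

Lemma cdeg_remove_r f v w i : (forall x y, f x y = f y x) -> e v w ->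
  cdeg e f i w = cdeg (remove_edge e v w) f i w + (f v w == i).
Proof. by move=> f_sym evw; rewrite (cdeg_remove_edge e_sym e_irr _ _ f_sym evw) eqxx orbT. Qed.

Lemma cdeg_remove_other f v w i u : (forall x y, f x y = f y x) -> e v w ->
  u != v -> u != w -> cdeg e f i u = cdeg (remove_edge e v w) f i u.
Proof.
move=> f_sym evw /negbTE uv /negbTE uw.
by rewrite (cdeg_remove_edge e_sym e_irr _ _ f_sym evw) uv uw addn0.
Qed.

Lemma weight_squares_le f k a b u : a != b ->
    (forall i, i != a -> i != b -> cdeg e k i u = cdeg e f i u) ->
    squares e a b k u <= squares e a b f u ->
  weight e k u <= weight e f u.
Proof. by move=> ab same; have := weight_two ab same; lia. Qed.

Lemma weight_same f k u : (forall i, cdeg e k i u = cdeg e f i u) ->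
  weight e k u = weight e f u.
Proof. by move=> same; apply: eq_bigr => i _; rewrite same. Qed.

Lemma weight_spread f k a b u : a != b ->
    (forall i, i != a -> i != b -> cdeg e k i u = cdeg e f i u) ->
    cdeg e k a u + cdeg e k b u = cdeg e f a u + cdeg e f b u ->
    minn (cdeg e f a u) (cdeg e f b u) <= cdeg e k a u ->
    minn (cdeg e f a u) (cdeg e f b u) <= cdeg e k b u ->
  weight e k u <= weight e f u.
Proof.
by move=> ab same *; apply: (weight_squares_le ab same); apply: squares_spread.
Qed.

Lemma weight_levelled f k a b u : a != b ->
    (forall i, i != a -> i != b -> cdeg e k i u = cdeg e f i u) ->
    cdeg e f a u = cdeg e f b u + 2 ->
    cdeg e k a u = cdeg e f b u + 1 -> cdeg e k b u = cdeg e f b u + 1 ->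
  weight e k u + 2 = weight e f u.
Proof.
move=> ab same E1 E2 E3; have := weight_two ab same.
rewrite /squares E1 E2 E3; lia.
Qed.

(* The weight of [v] drops by 2 when an excess of 2 is levelled, so optimality forbids
   doing so without increasing a weight elsewhere. *)
Lemma optimal_not_levelled f k a b v w : optimal e f -> a != b -> v != w ->
    cdeg e f a v = cdeg e f b v + 2 ->
    (forall x y, k x y = k y x) ->
    (forall i, i != a -> i != b -> cdeg e k i v = cdeg e f i v) ->
    cdeg e k a v = cdeg e f b v + 1 -> cdeg e k b v = cdeg e f b v + 1 ->
    weight e k w <= weight e f w ->
    (forall u, u != v -> u != w -> weight e k u <= weight e f u) -> False.
Proof.
move=> opt ab vw bad k_sym same ka kb kw ko.
have := weight_levelled ab same bad ka kb.
have := optimal_min opt k_sym vw ko; lia.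
Qed.

Lemma weight_upd_other f g a b c v w u : (forall x y, f x y = f y x) -> e v w ->
    a != b -> swaps (remove_edge e v w) a b f g -> u != v -> u != w ->
    squares (remove_edge e v w) a b g u <= squares (remove_edge e v w) a b f u ->
  weight e (recolour g v w c) u <= weight e f u.
Proof.
move=> f_sym evw ab sw uv uw le; apply: (weight_squares_le ab).
  by move=> i ia ib; rewrite cdeg_recolour_other // (cdeg_remove_other _ f_sym evw uv uw) (cdeg_swaps _ _ sw).
by rewrite /squares !cdeg_recolour_other // !(cdeg_remove_other _ f_sym evw uv uw).
Qed.

(** Some trail leaves [v] along [a] without ending in a [b]-edge at [v]. Flipping it moves one unit
    from [a] to [b] at [v], or two if it returns along [a]; from an excess of 3 on, both lower the
    potential. *)
Lemma optimal_gap f a b v : optimal e f -> cdeg e f a v <= cdeg e f b v + 2.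
Proof.
move=> opt; have [f_sym fmin] := opt.
have [->|ab] := eqVneq a b; first by rewrite leq_addr.
have baF : b == a = false by rewrite eq_sym (negbTE ab).
have abF := negbTE ab.
rewrite leqNgt; apply/negP => gap.
have [E [mt [EP mtP cardE flip2 _]]] := trail_flips v e_sym e_irr f_sym ab.
have [z] : exists2 z, z \in [set z in E | tip f z a v]
    & mt z \notin [set z in E | tip f z b v].
  apply: involution_escape; first by move=> z; rewrite inE => /andP[/mtP[]].
  rewrite !cardE ?eqxx ?orbT //= !subn0.
  by apply: leq_trans gap; rewrite ltnS leq_addr.
rewrite inE => /andP[zE /andP[/eqP z1 /eqP fz]]; have [mE _ _] := mtP z zE.
rewrite inE mE /= => mz.
have [k [k_sym sw eab noninc _]] := flip2 z zE.
suff lt : potential e k < potential e f by have := fmin k k_sym; rewrite leqNgt lt.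
rewrite /potential (bigD1 v) // [in X in _ < X](bigD1 v) //= -addSn leq_add //.
  have := weight_swaps e v ab sw; rewrite /squares; have [ea eb] := eab v.
  move: ea eb; rewrite /tip fz z1 !eqxx abF /=.
  have -> : ((mt z).1 == v) && (f (mt z).1 (mt z).2 == b) = false by apply/negbTE.
  rewrite !addn0.
  case: (_ && _); rewrite /= => ea eb E1.
    have [n En] : exists n, cdeg e f a v = cdeg e f b v + 3 + n.
      by exists (cdeg e f a v - cdeg e f b v - 3); clear -gap; lia.
    move: E1; have -> : cdeg e k a v = cdeg e f b v + n + 1 by clear -ea En; lia.
    have -> : cdeg e k b v = cdeg e f b v + 2 by clear -eb; lia.
    by rewrite En; clear; lia.
  have [n En] : exists n, cdeg e f a v = cdeg e f b v + 3 + n.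
    by exists (cdeg e f a v - cdeg e f b v - 3); clear -gap; lia.
  move: E1; have -> : cdeg e k a v = cdeg e f b v + n + 2 by clear -ea En; lia.
  have -> : cdeg e k b v = cdeg e f b v + 1 by clear -eb; lia.
  by rewrite En; clear; lia.
apply: leq_sum => u uv; apply: (weight_squares_le ab); last exact: noninc.
by move=> i; apply: cdeg_swaps sw.
Qed.

(** Otherwise the edge [v w], possibly after flipping trails in the rest of the graph, could be
    recoloured so as to level [v] without raising any other weight. *)
Lemma optimal_balanced f a b v w : optimal e f -> a != b ->
    cdeg e f a v = cdeg e f b v + 2 -> e v w -> f v w = a ->
  cdeg e f a w = cdeg e f b w.
Proof.
move=> opt ab bad evw fa; have [f_sym _] := opt; have vw := edge_neq evw.
have baF : b == a = false by rewrite eq_sym (negbTE ab).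
have abF := negbTE ab.
have val : cdeg e f a v = cdeg (remove_edge e v w) f a v + 1.
  by rewrite (cdeg_remove_l _ f_sym evw) fa eqxx.
have vbl : cdeg e f b v = cdeg (remove_edge e v w) f b v.
  by rewrite (cdeg_remove_l _ f_sym evw) fa abF addn0.
have wal : cdeg e f a w = cdeg (remove_edge e v w) f a w + 1.
  by rewrite (cdeg_remove_r _ f_sym evw) fa eqxx.
have wbl : cdeg e f b w = cdeg (remove_edge e v w) f b w.
  by rewrite (cdeg_remove_r _ f_sym evw) fa abF addn0.
have finish g d : (forall x y, g x y = g y x) -> swaps (remove_edge e v w) a b f g ->
    (d == a) || (d == b) ->
    cdeg (remove_edge e v w) g a v + (d == a) = cdeg e f b v + 1 ->
    cdeg (remove_edge e v w) g b v + (d == b) = cdeg e f b v + 1 ->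
    cdeg (remove_edge e v w) g a w + (d == a) + (cdeg (remove_edge e v w) g b w + (d == b))
      = cdeg e f a w + cdeg e f b w ->
    minn (cdeg e f a w) (cdeg e f b w) <= cdeg (remove_edge e v w) g a w + (d == a) ->
    minn (cdeg e f a w) (cdeg e f b w) <= cdeg (remove_edge e v w) g b w + (d == b) ->
    (forall u, u != v -> u != w ->
      squares (remove_edge e v w) a b g u <= squares (remove_edge e v w) a b f u) -> False.
  move=> g_sym sw dab ga gb gs g1 g2 go; have swk := swaps_recolour f_sym sw evw fa dab.
  apply: (optimal_not_levelled opt ab vw bad (recolour_sym v w d g_sym)).
  - by move=> i; apply: cdeg_swaps swk.
  - by rewrite cdeg_recolour_l.
  - by rewrite cdeg_recolour_l.
  - apply: (weight_spread ab); rewrite ?cdeg_recolour_r // => i.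
    by apply: cdeg_swaps swk.
  - by move=> u uv uw; apply: (weight_upd_other _ f_sym evw ab sw) => //; apply: go.
(* If [a] is commoner than [b] at [w], giving [v w] the colour [b] already levels [v]. *)
case: (ltngtP (cdeg e f b w) (cdeg e f a w)) => // c; exfalso.
  apply: (finish f b f_sym (@swaps_refl _ _ _ _)); rewrite ?eqxx ?orbT ?baF //.
  - by clear -bad val vbl; lia.
  - by clear -bad val vbl; lia.
  - by clear -wal wbl; lia.
  - by clear -wal wbl c; lia.
  - by clear -wal wbl c; lia.
(* If [a] is rarer at [w], deleting [v w] makes the deficit there at least 2, as [exchange]
   requires. The edge returns with colour [b], or with colour [a] if [v] has already lost a unit of
   [a]. *)
have h1 : cdeg (remove_edge e v w) f b v <= cdeg (remove_edge e v w) f a v by clear -bad val vbl; lia.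
have h2 : cdeg (remove_edge e v w) f a w + 2 <= cdeg (remove_edge e v w) f b w.
  by clear -wal wbl c; lia.
have [g [g_sym sw [[ga gb gaw gbw noninc]|[_ same [[ga gb gaw gbw]|[ga gb gaw gbw]]]]]] :=
  exchange v (remove_edge_sym e_sym v w) (remove_edge_irr e_irr v w) f_sym ab vw h1 h2.
- apply: (finish g b g_sym sw); rewrite ?eqxx ?orbT ?baF //.
  + by clear -bad val vbl ga gb; lia.
  + by clear -bad val vbl ga gb; lia.
  + by clear -wal wbl gaw gbw; lia.
  + by clear -wal wbl c gaw gbw; lia.
  + by clear -wal wbl c gaw gbw; lia.
  + by move=> u uv _; apply: noninc.
- apply: (finish g b g_sym sw); rewrite ?eqxx ?orbT ?baF //.
  + by clear -bad val vbl ga gb; lia.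
  + by clear -bad val vbl ga gb; lia.
  + by clear -wal wbl gaw gbw; lia.
  + by clear -wal wbl c gaw gbw; lia.
  + by clear -wal wbl c gaw gbw; lia.
  + by move=> u uv uw; rewrite /squares !same.
- apply: (finish g a g_sym sw); rewrite ?eqxx ?orbT ?abF //.
  + by clear -bad val vbl ga gb; lia.
  + by clear -bad val vbl ga gb; lia.
  + by clear -wal wbl gaw gbw; lia.
  + by clear -wal wbl c gaw gbw; lia.
  + by clear -wal wbl c gaw gbw; lia.
  + by move=> u uv uw; rewrite /squares !same.
Qed.

End Optimal.

(** * Shifting the excess at a vertex to another colour *)

Section Optimal2.

Variables (T C : finType) (e : rel T).
Hypotheses (e_sym : symmetric e) (e_irr : irreflexive e).
Implicit Types (f g k : T -> T -> C) (a b c i : C) (u v w : T).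

(** One step along a fan: the excess over [b] at [v] passes from [a] to [c] while optimality is
    kept. The edge [v y] keeps its colour, so it can serve as the next starting edge. *)
Lemma shift f a b c v w y : optimal e f -> a != b ->
    cdeg e f a v = cdeg e f b v + 2 -> e v w -> f v w = a ->
    cdeg e f c w != cdeg e f a w ->
    0 < cdeg e f c v /\ (e v y -> f v y = c ->
    exists k, [/\ optimal e k, swaps e a c f k, k v y = c,
      cdeg e k c v = cdeg e k b v + 2 &
      forall i u, u != v -> u != w -> cdeg e k i u = cdeg e f i u]).
Proof.
move=> opt ab bad evw fa cw; have [f_sym _] := opt; have vw := edge_neq e_irr evw.
have bal := optimal_balanced e_sym e_irr opt ab bad evw fa.
have ca : c != a by apply: contraNneq cw => ->.
have cb : c != b by apply: contraNneq cw => ->; rewrite bal.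
have ac : a != c by rewrite eq_sym.
have abF := negbTE ab; have acF := negbTE ac; have caF := negbTE ca.
have cbF := negbTE cb; have bcF : b == c = false by rewrite eq_sym.
have baF : b == a = false by rewrite eq_sym.
(* If [c] were as rare as [b] at [v], then [optimal_balanced] for [a] and [c] would give them equal
   degrees at [w]. *)
have c_low : cdeg e f c v != cdeg e f b v.
  apply: contraNneq cw => E1; rewrite -E1 in bad.
  by rewrite (optimal_balanced e_sym e_irr opt ac bad evw fa).
have c1 := optimal_gap e_sym e_irr a c v opt.
have c2 := optimal_gap e_sym e_irr c b v opt.
split; first by clear -c1 c2 c_low bad; lia.
move=> evy fy.
have [c_top|c_top] := eqVneq (cdeg e f c v) (cdeg e f b v + 2).
  by exists f; split=> //; apply: swaps_refl.
(* Interchanging the degrees of [a] and [c] at [v] now preserves its weight and gives [c] the excess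
   2. *)
have c_mid : cdeg e f c v = cdeg e f b v + 1 by clear -c1 c2 c_low c_top bad; lia.
have yw : y != w by apply: contraNneq ca => E1; rewrite -fy E1 fa.
have yv : y != v by rewrite eq_sym; apply: edge_neq evy.
have updy g d : recolour g v w d v y = g v y.
  by rewrite /recolour !xpair_eqE eqxx (negbTE yw) (negbTE yv) (negbTE vw).
have vl i : cdeg e f i v = cdeg (remove_edge e v w) f i v + (a == i).
  by rewrite (cdeg_remove_l e_sym e_irr _ f_sym evw) fa.
have wl i : cdeg e f i w = cdeg (remove_edge e v w) f i w + (a == i).
  by rewrite (cdeg_remove_r e_sym e_irr _ f_sym evw) fa.
have val := vl a; have vbl := vl b; have vcl := vl c.
have wal := wl a; have wbl := wl b; have wcl := wl c.
rewrite ?eqxx ?abF ?acF ?addn0 in val vbl vcl wal wbl wcl.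
(* Recolouring so that only [v] and [w] change, [c] taking over the excess of [a] at [v]. *)
have finish g d : (forall x y, g x y = g y x) -> swaps (remove_edge e v w) a c f g ->
    (d == a) || (d == c) -> g v y = c ->
    cdeg (remove_edge e v w) g a v + (d == a) = cdeg e f c v ->
    cdeg (remove_edge e v w) g c v + (d == c) = cdeg e f a v ->
    cdeg (remove_edge e v w) g a w + (d == a) + (cdeg (remove_edge e v w) g c w + (d == c))
      = cdeg e f a w + cdeg e f c w ->
    minn (cdeg e f a w) (cdeg e f c w) <= cdeg (remove_edge e v w) g a w + (d == a) ->
    minn (cdeg e f a w) (cdeg e f c w) <= cdeg (remove_edge e v w) g c w + (d == c) ->
    (forall i u, u != v -> u != w -> cdeg (remove_edge e v w) g i u = cdeg (remove_edge e v w) f i u) ->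
    exists k, [/\ optimal e k, swaps e a c f k, k v y = c,
      cdeg e k c v = cdeg e k b v + 2 &
      forall i u, u != v -> u != w -> cdeg e k i u = cdeg e f i u].
  move=> g_sym sw dac gy ga gc gs g1 g2 go.
  have swk := swaps_recolour e_sym f_sym sw evw fa dac.
  have other i u : u != v -> u != w -> cdeg e (recolour g v w d) i u = cdeg e f i u.
    by move=> uv uw; rewrite cdeg_recolour_other // go // -(cdeg_remove_other e_sym e_irr).
  exists (recolour g v w d); split=> //; last 2 first.
  - by rewrite updy.
  - by rewrite cdeg_recolour_l // gc bad; congr (_ + _); rewrite (cdeg_swaps e v swk) // eq_sym.
  apply: (optimal_eq opt (recolour_sym v w d g_sym) vw).
    by move=> u uv uw; rewrite (weight_same (f := f)) // => i; apply: other.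
  apply: leq_add.
    apply: (weight_spread ac); rewrite ?cdeg_recolour_l ?ga ?gc 1?addnC ?geq_minl ?geq_minr //.
    by move=> i; apply: cdeg_swaps swk.
  apply: (weight_spread ac); rewrite ?cdeg_recolour_r // => i.
  by apply: cdeg_swaps swk.
case: (ltngtP (cdeg e f c w) (cdeg e f a w)) cw => // cmp _.
  apply: (finish f c f_sym (@swaps_refl _ _ _ _ _ _)); rewrite ?eqxx ?orbT ?caF //.
  - by clear -bad c_mid val vcl; lia.
  - by clear -bad c_mid val vcl; lia.
  - by clear -wal wcl; lia.
  - by clear -cmp wal wcl; lia.
  - by clear -cmp wal wcl; lia.
have h1 : cdeg (remove_edge e v w) f c v <= cdeg (remove_edge e v w) f a v.
  by clear -bad c_mid val vcl; lia.
have h2 : cdeg (remove_edge e v w) f a w + 2 <= cdeg (remove_edge e v w) f c w.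
  by clear -cmp wal wcl; lia.
have [g [g_sym sw [[ga gc gaw gcw noninc]|[gy same [[ga gc gaw gcw]|[ga gc gaw gcw]]]]]] :=
  exchange y (remove_edge_sym e_sym v w) (remove_edge_irr e_irr v w) f_sym ac vw h1 h2.
(* Here [v] is unchanged and [w] has one [c]-edge fewer. Returning [v w] with colour [b] would level
   [a] and [b] at [v]; at [w] it moves a unit from [c] to the rarer colour [b], against
   optimality. *)
- exfalso.
  have gb u : cdeg (remove_edge e v w) g b u = cdeg (remove_edge e v w) f b u.
    by apply: cdeg_swaps sw _ _; rewrite eq_sym // eq_sym.
  have gi i u : i != a -> i != c -> cdeg (remove_edge e v w) g i u = cdeg (remove_edge e v w) f i u.
    by move=> ia ic; apply: cdeg_swaps sw _ _.
  apply: (optimal_not_levelled opt ab vw bad (recolour_sym v w b g_sym)).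
  + move=> i ia ib; rewrite cdeg_recolour_l // vl eq_sym (negbTE ib) (eq_sym a) (negbTE ia).
    rewrite !addn0; have [->//|ic] := eqVneq i c; exact: gi.
  + by rewrite cdeg_recolour_l // baF; clear -ga val bad; lia.
  + by rewrite cdeg_recolour_l // eqxx gb; clear -vbl; lia.
  + apply: (weight_spread cb).
    * move=> i ic ib; rewrite cdeg_recolour_r // wl (eq_sym b) (negbTE ib) (eq_sym a).
      have [->|ia] := eqVneq i a; first by clear -gaw; lia.
      by rewrite gi.
    * by rewrite !cdeg_recolour_r // bcF eqxx gb; clear -gcw wcl wbl; lia.
    * by rewrite !cdeg_recolour_r // bcF; clear -gcw wcl wbl cmp wal bal; lia.
    * by rewrite !cdeg_recolour_r // eqxx gb; clear -gcw wcl wbl cmp wal bal; lia.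
  + by move=> u uv uw; apply: (weight_upd_other e_sym e_irr _ f_sym evw ac sw) => //; apply: noninc.
- apply: (finish g c g_sym sw); rewrite ?eqxx ?orbT ?caF //.
  + exact: gy.
  + by clear -bad c_mid val vcl ga; lia.
  + by clear -bad c_mid val vcl gc; lia.
  + by clear -wal wcl gaw gcw; lia.
  + by clear -cmp wal wcl gaw gcw; lia.
  + by clear -cmp wal wcl gaw gcw; lia.
- apply: (finish g a g_sym sw); rewrite ?eqxx ?orbT ?acF //.
  + exact: gy.
  + by clear -bad c_mid val vcl ga; lia.
  + by clear -bad c_mid val vcl gc; lia.
  + by clear -wal wcl gaw gcw; lia.
  + by clear -cmp wal wcl gaw gcw; lia.
  + by clear -cmp wal wcl gaw gcw; lia.
Qed.

End Optimal2.

(** * Changing a colour degree away from a given edge *)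

Section Optimal3.

Variables (T C : finType) (e : rel T).
Hypotheses (e_sym : symmetric e) (e_irr : irreflexive e).
Implicit Types (f g k : T -> T -> C) (a b c i : C) (u v w : T).

(** A trail ending at [u0] is flipped in the graph without [v w]. Optimality excludes that it ends
    at [v] or [w], so nothing changes at these two vertices. *)
Lemma perturb f a b v w u0 : optimal e f -> a != b ->
    cdeg e f a v = cdeg e f b v + 2 -> e v w -> f v w = a ->
    u0 != v -> u0 != w -> cdeg e f a u0 != cdeg e f b u0 ->
  exists k, [/\ optimal e k, swaps e a b f k, k v w = a,
    forall i, cdeg e k i v = cdeg e f i v /\ cdeg e k i w = cdeg e f i w &
    cdeg e k b u0 != cdeg e f b u0].
Proof.
move=> opt ab bad evw fa u0v u0w odd0; have [f_sym _] := opt.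
have vw := edge_neq e_irr evw.
have bal := optimal_balanced e_sym e_irr opt ab bad evw fa.
have abF := negbTE ab; have baF : b == a = false by rewrite eq_sym.
have vwF := negbTE vw; have wvF : w == v = false by rewrite eq_sym.
have u0vF := negbTE u0v; have u0wF := negbTE u0w.
have val : cdeg e f a v = cdeg (remove_edge e v w) f a v + 1.
  by rewrite (cdeg_remove_l e_sym e_irr _ f_sym evw) fa eqxx.
have vbl : cdeg e f b v = cdeg (remove_edge e v w) f b v.
  by rewrite (cdeg_remove_l e_sym e_irr _ f_sym evw) fa abF addn0.
have wal : cdeg e f a w = cdeg (remove_edge e v w) f a w + 1.
  by rewrite (cdeg_remove_r e_sym e_irr _ f_sym evw) fa eqxx.
have wbl : cdeg e f b w = cdeg (remove_edge e v w) f b w.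
  by rewrite (cdeg_remove_r e_sym e_irr _ f_sym evw) fa abF addn0.
rewrite !(cdeg_remove_other e_sym e_irr _ f_sym evw u0v u0w) in odd0.
have [E [mt [EP mtP cardE flip2 flip4]]] :=
  trail_flips v (remove_edge_sym e_sym v w) (remove_edge_irr e_irr v w) f_sym ab.
have finish g d : (forall x y, g x y = g y x) -> swaps (remove_edge e v w) a b f g ->
    (forall u, u != v -> squares (remove_edge e v w) a b g u <= squares (remove_edge e v w) a b f u) ->
    (d == a) || (d == b) ->
    cdeg (remove_edge e v w) g a v + (d == a) = cdeg e f b v + 1 ->
    cdeg (remove_edge e v w) g b v + (d == b) = cdeg e f b v + 1 ->
    cdeg (remove_edge e v w) g a w + (d == a) = cdeg e f a w ->
    cdeg (remove_edge e v w) g b w + (d == b) = cdeg e f b w -> False.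
  move=> g_sym sw noninc dab ga gb gaw gbw.
  have swk := swaps_recolour e_sym f_sym sw evw fa dab.
  apply: (optimal_not_levelled opt ab vw bad (recolour_sym v w d g_sym)).
  - by move=> i; apply: cdeg_swaps swk.
  - by rewrite cdeg_recolour_l.
  - by rewrite cdeg_recolour_l.
  - apply: (weight_squares_le ab); last by rewrite /squares !cdeg_recolour_r // gaw gbw.
    by move=> i; apply: cdeg_swaps swk.
  - move=> u uv uw; apply: (weight_upd_other e_sym e_irr _ f_sym evw ab sw) => //.
    exact: noninc.
have endsP i z u : (i == a) || (i == b) -> z \in E -> z.1 = u -> f z.1 z.2 = i ->
    u != v -> cdeg (remove_edge e v w) f (if i == a then b else a) u < cdeg (remove_edge e v w) f i u.
  move=> iab zE zu fz uv; have := cardE i u iab; rewrite (negbTE uv).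
  rewrite -subn_gt0 => <-; apply/card_gt0P; exists z.
  by rewrite inE zE /tip fz zu !eqxx.
(* The [a]- and [b]-degrees at [u0] differ, so some dart there is unpaired. *)
have [x xE x1] : exists2 x, x \in E & x.1 = u0.
  have [i iab gt] : exists2 i, (i == a) || (i == b) & 0 < cdeg (remove_edge e v w) f i u0
      - (if u0 == v then 0 else cdeg (remove_edge e v w) f (if i == a then b else a) u0).
    rewrite u0vF; case: (ltngtP (cdeg (remove_edge e v w) f a u0) (cdeg (remove_edge e v w) f b u0)) odd0.
    - by move=> lt _; exists b; rewrite ?baF ?eqxx ?orbT // subn_gt0.
    - by move=> lt _; exists a; rewrite ?eqxx // subn_gt0.
    - by [].
  move: gt; rewrite -cardE // => /card_gt0P[x]; rewrite inE => /andP[xE /andP[/eqP x1 _]].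
  by exists x.
have [mE mx mK] := mtP x xE.
have tipx i u : u != u0 -> tip f x i u = false.
  by rewrite /tip x1 eq_sym => /negbTE->.
have no_aw z : z \in E -> z.1 = w -> f z.1 z.2 = b.
  move=> zE zw; case/orP: (EP z zE) => /eqP // fz; exfalso.
  have := endsP a z w _ zE zw fz; rewrite eqxx wvF => /(_ isT isT).
  by clear -wal wbl bal; lia.
have [g [g_sym sw eab noninc _]] := flip2 x xE.
have [mv|mv] := eqVneq (mt x).1 v.
  exfalso; case/orP: (EP _ mE) => /eqP fm.
    have [va vb] := eab v; have [wa wb] := eab w; move: va vb wa wb.
    rewrite !(tipx _ v) 1?eq_sym // !(tipx _ w) 1?eq_sym //.
    rewrite /tip fm mv !eqxx abF vwF /= => va vb wa wb.
    apply: (finish g a g_sym sw noninc); rewrite ?eqxx ?abF //.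
    - by clear -val vbl bad va; lia.
    - by clear -vbl vb; lia.
    - by clear -wal wa; lia.
    - by clear -wbl wb; lia.
  have mxB : mt x \in [set z in E | tip f z b v] by rewrite inE mE /tip fm mv !eqxx.
  (* The flip of [x] would worsen [v], so another trail is sought. Let B be the [b]-degree of [v].
     Without [v w] there are B + 1 [a]-ends at [v], but only B - 1 [b]-ends at [v] besides [mt x],
     and one [b]-end at [w]. *)
  have [z] : exists2 z, z \in [set z in E | tip f z a v]
      & mt z \notin ([set z in E | tip f z b v] :\ mt x) :|: [set z in E | tip f z b w].
    apply: involution_escape; first by move=> z; rewrite inE => /andP[/mtP[]].
    apply: leq_ltn_trans (leq_card_setU _ _) _.
    have := cardsD1 (mt x) [set z in E | tip f z b v]; rewrite mxB.
    rewrite !cardE ?eqxx ?orbT //= wvF baF !subn0 => E1.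
    move: #|_| E1 => n; clear -val vbl wal wbl bal bad; lia.
  rewrite inE => /andP[zE /andP[/eqP z1 /eqP fz]].
  have [mzE _ mzK] := mtP z zE; rewrite !inE mzE !negb_or negb_and negbK => /andP[mz mzw].
  have zx : z != x by apply: contraNneq u0v => E1; rewrite -x1 -E1 z1.
  have zmx : z != mt x by apply: contraNneq ab => E1; rewrite -fz E1 fm.
  have {}mz : ~~ tip f (mt z) b v.
    case/orP: mz => // /eqP E1; case/negP: zx; apply/eqP.
    by rewrite -mzK E1 mK.
  have {}mzw : (mt z).1 != w.
    by apply: contraNneq mzw => E1; rewrite /tip (no_aw _ mzE E1) E1 !eqxx.
  (* If the new trail leaves [v] for good, flipping it alone levels [v]; if it returns along [a],
     flipping it together with the trail of [x] does. *)
  have [mzv|mzv] := eqVneq (mt z).1 v; last first.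
    have [g' [g'_sym sw' eab' noninc' _]] := flip2 z zE.
    have [va vb] := eab' v; have [wa wb] := eab' w; move: va vb wa wb.
    rewrite /tip fz z1 (negbTE mzv) (negbTE mzw) !eqxx abF vwF /= => va vb wa wb.
    apply: (finish g' a g'_sym sw' noninc'); rewrite ?eqxx ?abF //.
    - by clear -val vbl bad va; lia.
    - by clear -vbl vb; lia.
    - by clear -wal wa; lia.
    - by clear -wbl wb; lia.
  have fmz : f (mt z).1 (mt z).2 = a.
    by case/orP: (EP _ mzE) => /eqP // fmz; case/negP: mz; rewrite /tip fmz mzv !eqxx.
  have [g' [g'_sym sw' eab' noninc' _]] := flip4 x z xE zE zx zmx.
  have [va vb] := eab' v; have [wa wb] := eab' w; move: va vb wa wb.
  rewrite !(tipx _ v) 1?eq_sym // !(tipx _ w) 1?eq_sym //.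
  rewrite /tip fm mv fz z1 fmz mzv !eqxx abF baF vwF /= => va vb wa wb.
  apply: (finish g' a g'_sym sw' noninc'); rewrite ?eqxx ?abF //.
  - by clear -val vbl bad va; lia.
  - by clear -vbl vb; lia.
  - by clear -wal wa; lia.
  - by clear -wbl wb; lia.
(* A trail ending at [w] does so in colour [b]. Its flip and colour [b] for [v w] would level [v]
   and restore the degrees at [w]. *)
have [mw|mw] := eqVneq (mt x).1 w.
  exfalso; have fm := no_aw _ mE mw.
  have [va vb] := eab v; have [wa wb] := eab w; move: va vb wa wb.
  rewrite !(tipx _ v) 1?eq_sym // !(tipx _ w) 1?eq_sym //.
  rewrite /tip fm mw !eqxx baF wvF /= => va vb wa wb.
  apply: (finish g b g_sym sw noninc); rewrite ?eqxx ?baF ?orbT //.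
  - by clear -val vbl bad va; lia.
  - by clear -vbl vb; lia.
  - by clear -wal wa; lia.
  - by clear -wbl wb wal wa bal; lia.
have gab i : (i == a) || (i == b) -> cdeg (remove_edge e v w) g i v = cdeg (remove_edge e v w) f i v /\
    cdeg (remove_edge e v w) g i w = cdeg (remove_edge e v w) f i w.
  have [va vb] := eab v; have [wa wb] := eab w; move: va vb wa wb.
  rewrite !(tipx _ v) 1?eq_sym // !(tipx _ w) 1?eq_sym //.
  rewrite /tip (negbTE mv) (negbTE mw) /= !addn0.
  by move=> va vb wa wb /orP[]/eqP->.
have gE i : cdeg (remove_edge e v w) g i v = cdeg (remove_edge e v w) f i v /\
    cdeg (remove_edge e v w) g i w = cdeg (remove_edge e v w) f i w.
  have [iab|] := boolP ((i == a) || (i == b)); first exact: gab.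
  by rewrite negb_or => /andP[ia ib]; rewrite !(cdeg_swaps _ _ sw).
have kE i : cdeg e (recolour g v w a) i v = cdeg e f i v /\
    cdeg e (recolour g v w a) i w = cdeg e f i w.
  have [gv gw] := gE i; rewrite cdeg_recolour_l // cdeg_recolour_r // gv gw.
  by rewrite (cdeg_remove_l e_sym e_irr _ f_sym evw) (cdeg_remove_r e_sym e_irr _ f_sym evw) fa.
exists (recolour g v w a); split=> //.
- apply: (optimal_eq opt (recolour_sym v w a g_sym) vw).
    move=> u uv uw; apply: (weight_upd_other e_sym e_irr _ f_sym evw ab sw) => //.
    exact: noninc.
  by rewrite !(weight_same (f := f)) // => i; have [] := kE i.
- by apply: swaps_recolour evw fa _; rewrite ?eqxx.
- by rewrite /recolour eqxx.
rewrite cdeg_recolour_other // (cdeg_remove_other e_sym e_irr _ f_sym evw u0v u0w).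
(* All trail ends at [u0] have the same colour, so the change there is not cancelled even if both
   ends of the flipped trail lie at [u0]. *)
have [_ vb] := eab u0; move: vb; rewrite /tip x1 eqxx /=.
case/orP: (EP x xE) => /eqP fx; have := endsP _ x u0 _ xE x1 fx u0v;
  rewrite ?eqxx ?baF ?orbT => /(_ isT) lt;
  rewrite x1 in fx; rewrite fx ?eqxx ?abF ?baF /=.
- have -> : ((mt x).1 == u0) && (f (mt x).1 (mt x).2 == b) = false.
    apply/negP => /andP[/eqP m1 /eqP fm]; have := endsP _ _ u0 _ mE m1 fm u0v.
    by rewrite eqxx baF orbT => /(_ isT); clear -lt; lia.
  by move=> E1; apply/eqP => E2; move: E1; rewrite E2; case: (_ && _); clear; lia.
- have -> : ((mt x).1 == u0) && (f (mt x).1 (mt x).2 == a) = false.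
    apply/negP => /andP[/eqP m1 /eqP fm]; have := endsP _ _ u0 _ mE m1 fm u0v.
    by rewrite eqxx => /(_ isT); clear -lt; lia.
  by move=> E1; apply/eqP => E2; move: E1; rewrite E2; case: (_ && _); clear; lia.
Qed.

End Optimal3.

(** * Fans *)

Section Fans.

Variables (T C : finType) (e : rel T).
Hypotheses (e_sym : symmetric e) (e_irr : irreflexive e).
Variables (b : C) (v : T).
Implicit Types (f k : T -> T -> C) (a c : C) (w y : T) (s : seq (C * T)).

(** An item pairs a colour with the end of an edge at [v] of that colour. The next colour must
    differ in degree, at the previous end, from the previous colour, which is the hypothesis of
    [shift]. Distinctness of colours is required separately. *)
Fixpoint fan f a w s :=
  if s is (c, y) :: s' then
    [&& e v y, f v y == c, cdeg e f c w != cdeg e f a w & fan f c y s']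
  else true.

Lemma fan_last_edge f a w s : e v w -> f v w = a -> fan f a w s ->
  e v (last (a, w) s).2 /\ f v (last (a, w) s).2 = (last (a, w) s).1.
Proof.
elim: s a w => [|[c y] s IHs] a w //= _ _ /and4P[vy /eqP fy _].
exact: IHs.
Qed.

Lemma fan_rcons f a w s c y : fan f a w s -> e v y -> f v y = c ->
    cdeg e f c (last (a, w) s).2 != cdeg e f (last (a, w) s).1 (last (a, w) s).2 ->
  fan f a w (rcons s (c, y)).
Proof.
elim: s a w => [|[d z] s IHs] a w /=; first by move=> _ -> -> ->; rewrite eqxx.
by move=> /and4P[-> -> -> fs] vy fy ne; rewrite IHs.
Qed.

(** The later edges have colours other than [a] and [c], so they keep them. They also differ from
    the edge [v w], so their ends are not [w] and keep all degrees. *)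
Lemma fan_shift f k a c d w y s : swaps e a c f k -> f v w = a ->
    (forall i u, u != v -> u != w -> cdeg e k i u = cdeg e f i u) ->
    a \notin map fst s -> c \notin map fst s -> e v y -> y != w -> fan f d y s ->
  fan k d y s /\ (last (d, y) s).2 != w.
Proof.
move=> sw fw same; elim: s d y => [|[c' y'] s IHs] d y //=.
rewrite !inE !negb_or => /andP[ac' as'] /andP[cc' cs'] vy yw /and4P[vy' fy' ne fs].
have y'w : y' != w by apply: contraNneq ac' => E1; rewrite -fw -E1.
have ky' : k v y' = f v y'.
  apply/eqP; apply: contraT => /sw/and3P[_]; rewrite (eqP fy').
  by rewrite ![c' == _]eq_sym (negbTE ac') (negbTE cc').
have yv : y != v by rewrite eq_sym; apply: edge_neq vy.
have [-> ->] := IHs c' y' as' cs' vy' y'w fs.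
by rewrite vy' ky' fy' !same ?ne.
Qed.

Lemma fan_swaps f k a c w s : swaps e a b f k ->
    a \notin map fst s -> b \notin map fst s -> c != a -> c != b ->
  fan f c w s -> fan k c w s.
Proof.
move=> sw; elim: s c w => [|[c' y'] s IHs] c w //=.
rewrite !inE !negb_or => /andP[ac' as'] /andP[bc' bs'] ca cb /and4P[vy' fy' ne fs].
have c'a : c' != a by rewrite eq_sym.
have c'b : c' != b by rewrite eq_sym.
have ky' : k v y' = f v y'.
  apply/eqP; apply: contraT => /sw/and3P[_]; rewrite (eqP fy').
  by rewrite (negbTE c'a) (negbTE c'b).
by rewrite vy' ky' fy' IHs // !(cdeg_swaps _ _ sw) // ne.
Qed.

(** Shifting the excess along the fan brings it to the last colour, where [optimal_balanced]
    applies; no shift alters the degrees at the last end. *)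
Lemma fan_balanced f a w s : optimal e f -> uniq (b :: a :: map fst s) ->
    cdeg e f a v = cdeg e f b v + 2 -> e v w -> f v w = a -> fan f a w s ->
  cdeg e f (last (a, w) s).1 (last (a, w) s).2 = cdeg e f b (last (a, w) s).2.
Proof.
elim: s f a w => [|[c y] s IHs] f a w opt un bad vw fw.
  move=> _; apply: (optimal_balanced e_sym e_irr opt _ bad vw fw).
  by move: un; rewrite /= !inE andbT eq_sym.
move=> /= /and4P[vy /eqP fy ne fs]; move: un => /=.
rewrite !inE !negb_or => /and4P[/and3P[ba bc bs] /andP[ac as'] cs us].
have ab : a != b by rewrite eq_sym.
have [_ /(_ vy fy)[k [kopt sw ky kbad same]]] :=
  shift e_sym e_irr y opt ab bad vw fw ne.
have yw : y != w by apply: contraNneq ac => E1; rewrite -fw -E1 fy.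
have [kfan lw] := fan_shift sw fw same as' cs vy yw fs.
have [vl _] := fan_last_edge vy fy fs.
have lv : (last (c, y) s).2 != v by rewrite eq_sym; apply: edge_neq vl.
rewrite -!(same _ _ lv lw); apply: IHs => //.
by rewrite /= inE negb_or bc bs cs.
Qed.

(** By induction along the fan: after a shift from [a] to [c] the rest is a fan starting with [c].
    This settles every colour except [b], excluded by [fan_balanced], and [a]. *)
Lemma fan_next f a w s d : optimal e f -> uniq (b :: a :: map fst s) ->
    cdeg e f a v = cdeg e f b v + 2 -> e v w -> f v w = a -> fan f a w s ->
    cdeg e f d (last (a, w) s).2 != cdeg e f (last (a, w) s).1 (last (a, w) s).2 ->
  d \notin b :: a :: map fst s /\ 0 < cdeg e f d v.
Proof.
move=> opt un bad vw fw fs ne.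
have db : d != b.
  by apply: contraNneq ne => ->; rewrite (fan_balanced opt un bad vw fw fs).
elim: s f a w opt un bad vw fw fs ne => [|[c y] s IHs] f a w opt un bad vw fw.
  move=> _ /= ne; have ab : a != b by move: un; rewrite /= !inE andbT eq_sym.
  have [pos _] := shift e_sym e_irr w opt ab bad vw fw ne; split=> //.
  by rewrite !inE (negbTE db) /=; apply: contraNneq ne => ->.
move=> fan0 ne0; have bal0 := fan_balanced opt un bad vw fw fan0.
move: fan0 ne0 bal0 => /= /and4P[vy /eqP fy ne fs] ned bal; have un0 := un.
move: un => /=.
rewrite !inE !negb_or => /and4P[/and3P[ba bc bs] /andP[ac as'] cs us].
have ab : a != b by rewrite eq_sym.
have [vl fl] := fan_last_edge vy fy fs.
have lv : (last (c, y) s).2 != v by rewrite eq_sym; apply: edge_neq vl.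
have yw : y != w by apply: contraNneq ac => E1; rewrite -fw -E1 fy.
have [_ /(_ vy fy)[k [kopt sw ky kbad same]]] :=
  shift e_sym e_irr y opt ab bad vw fw ne.
have [kfan lw] := fan_shift sw fw same as' cs vy yw fs.
(* If [d = a], the [a]- and [b]-degrees at the last end differ. Then [perturb] changes its
   [b]-degree but not its degree in the last colour, and keeps the fan, so [fan_balanced] cannot
   hold both before and after. *)
have da : d != a.
  apply: contraNneq ned => da; apply: contraT => ned.
  have odd : cdeg e f a (last (c, y) s).2 != cdeg e f b (last (c, y) s).2.
    by rewrite -bal -da.
  have [g [gopt gsw gw gvw gb]] := perturb e_sym e_irr opt ab bad vw fw lv lw odd.
  have gfan : fan g a w ((c, y) :: s).
    rewrite /= vy; have [_ gcw] := gvw c; have [_ gaw] := gvw a.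
    rewrite gcw gaw ne.
    have ca : c != a by rewrite eq_sym.
    have cb : c != b by rewrite eq_sym.
    have -> : g v y = f v y.
      apply/eqP; apply: contraT => /gsw/and3P[_]; rewrite fy.
      by rewrite (negbTE ca) (negbTE cb).
    by rewrite fy eqxx (fan_swaps gsw as' bs ca cb fs).
  have gbad : cdeg e g a v = cdeg e g b v + 2.
    by have [-> _] := gvw a; have [-> _] := gvw b.
  have := fan_balanced gopt un0 gbad vw gw gfan; move=> /= E1.
  case/negP: gb; rewrite -E1 -bal; apply/eqP; apply: cdeg_swaps gsw _ _.
    have : (last (c, y) s).1 \in c :: map fst s.
      by rewrite -(last_map fst) mem_last.
    by apply: contraTneq => ->; rewrite inE negb_or ac.
  have : (last (c, y) s).1 \in c :: map fst s.
    by rewrite -(last_map fst) mem_last.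
  by apply: contraTneq => ->; rewrite inE negb_or bc.
have unk : uniq (b :: c :: map fst s) by rewrite /= inE negb_or bc bs cs.
rewrite -!(same _ _ lv lw) in ned.
have [] := IHs k c y kopt unk kbad vy ky kfan ned.
rewrite !inE (negbTE db) (negbTE da) /= negb_or => /andP[dc ds].
by rewrite (negbTE dc) ds (cdeg_swaps _ _ sw).
Qed.

End Fans.

(** * Existence of equitable colourings *)

Section Equitable.

Variables (T C : finType) (e : rel T).
Hypotheses (e_sym : symmetric e) (e_irr : irreflexive e).

Lemma sum_cdeg (f : T -> T -> C) u : \sum_i cdeg e f i u = #|[pred y | e u y]|.
Proof.
rewrite -sum1_card (partition_big (f u) predT) //=; apply: eq_bigr => i _.
by rewrite sum1_card; apply: eq_card => y; rewrite !inE.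
Qed.

Lemma optimal_exists : 0 < #|C| -> exists f : T -> T -> C, optimal e f.
Proof.
move=> /card_gt0P[c0 _].
(* Colourings become finite functions on pairs so that a minimum over a finite type exists. *)
pose app (F : {ffun T * T -> C}) x y := F (x, y).
pose symb (F : {ffun T * T -> C}) := [forall x, forall y, F (x, y) == F (y, x)].
have symP F : reflect (forall x y, app F x y = app F y x) (symb F).
  apply: (iffP forallP) => [h x y|h x]; first exact/eqP/(forallP (h x)).
  by apply/forallP => y; apply/eqP; apply: h.
have sym0 : symb [ffun _ => c0] by apply/symP => x y; rewrite /app !ffunE.
case: (@arg_minnP _ [ffun _ => c0] symb (fun F => potential e (app F)) sym0).
move=> F /symP F_sym Fmin; exists (app F); split=> // g g_sym.
have E1 : forall x y, app [ffun z => g z.1 z.2] x y = g x y.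
  by move=> x y; rewrite /app ffunE.
have : symb [ffun z => g z.1 z.2] by apply/symP => x y; rewrite !E1.
move/Fmin => /leq_trans; apply; apply: eq_leq; apply: eq_bigr => u _.
by apply: weight_same => i; apply: eq_card => y; rewrite !inE E1.
Qed.

Theorem equitable_colouring : 0 < #|C| ->
    (forall u, 0 < #|[pred y | e u y]| -> ~~ (#|C| %| #|[pred y | e u y]|)) ->
  exists f : T -> T -> C, (forall x y, f x y = f y x) /\
    forall i j u, cdeg e f i u <= cdeg e f j u + 1.
Proof.
move=> C_gt0 ndiv; have [f opt] := optimal_exists C_gt0; have [f_sym _] := opt.
exists f; split=> // a b v; rewrite leqNgt; apply/negP => gap.
have bad : cdeg e f a v = cdeg e f b v + 2.
  by have := optimal_gap e_sym e_irr a b v opt; lia.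
have ba : b != a by apply: contraTneq gap => ->; rewrite -leqNgt leq_addr.
have edge i : 0 < cdeg e f i v -> exists2 w, e v w & f v w = i.
  by case/card_gt0P => w; rewrite !inE => /andP[vw /eqP fw]; exists w.
have [|w vw fw] := edge a; first by rewrite bad addn2.
(* A fan with distinct colours can always be prolonged, until the colours run out. *)
have long n : exists s, [/\ size s = n, uniq (b :: a :: map fst s) & fan e v f a w s].
  elim: n => [|n [s [sz un fs]]]; first by exists [::]; rewrite /= inE ba.
  have [vl fl] := fan_last_edge vw fw fs.
  set l := last (a, w) s in vl fl.
  (* If all colour degrees at the last end were equal, the number of colours would divide its
     degree, which is positive because of [v]. *)
  have [d ne] : exists d, cdeg e f d l.2 != cdeg e f l.1 l.2.
    apply/existsP; apply: contraT => /existsPn same.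
    have deg : 0 < #|[pred y | e l.2 y]|.
      by apply/card_gt0P; exists v; rewrite inE e_sym.
    case/negP: (ndiv _ deg); rewrite -(sum_cdeg f).
    rewrite (eq_bigr (fun _ => cdeg e f l.1 l.2)) => [|i _].
      by rewrite sum_nat_const dvdn_mulr.
    by apply/eqP; have := same i; rewrite negbK.
  have [new /edge[y vy fy]] := fan_next e_sym e_irr opt un bad vw fw fs ne.
  exists (rcons s (d, y)); split.
  - by rewrite size_rcons sz.
  - by rewrite map_rcons -!rcons_cons rcons_uniq new.
  - by apply: fan_rcons fs vy fy _.
have [s [sz un _]] := long #|C|.
have := max_card (mem (b :: a :: map fst s)); rewrite (card_uniqP un).
by rewrite /= size_map sz ltnNge leqnSn.
Qed.

End Equitable.

(** * Factorizations *)

Lemma card_sum_pred (S T : finType) (P : pred (S + T)) :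
  #|[pred y | P y]| = #|[pred x | P (inl x)]| + #|[pred x | P (inr x)]|.
Proof. by rewrite -!sum1_card big_sumType. Qed.

(** * Attaching pendant edges *)

Section Pendant.

Variables (T : finType) (e : rel T) (k : nat).
Hypotheses (e_sym : symmetric e) (e_irr : irreflexive e).

(** [inr u] is the leaf reserved for [u]; it stays isolated when [k] does not divide the degree of
    [u]. *)
Definition pendant : rel (T + T) := fun x y =>
  match x, y with
  | inl u, inl w => e u w
  | inl u, inr w | inr w, inl u => (u == w) && (k %| degree e u)
  | inr _, inr _ => false
  end.

Lemma pendant_sym : symmetric pendant.
Proof. by case=> u [] w //=. Qed.

Lemma pendant_irr : irreflexive pendant.
Proof. by case=> u /=. Qed.

Lemma card_pick1 (u : T) (b : bool) (P : pred T) :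
  #|[pred y | (u == y) && b & P y]| = (b && P u).
Proof.
case: (boolP (b && P u)) => [/andP[-> Pu]|nb].
  rewrite -[RHS](card1 u); apply: eq_card => y; rewrite !inE andbT eq_sym.
  by case: (y =P u) => [->|].
apply: eq_card0 => y; rewrite !inE; apply: contraNF nb.
by case/andP => /andP[/eqP-> ->].
Qed.

Lemma cdeg_pendant (F : T + T -> T + T -> 'I_k) i u :
  cdeg pendant F i (inl u)
  = cdeg e (fun x y => F (inl x) (inl y)) i u
    + ((k %| degree e u) && (F (inl u) (inr u) == i)).
Proof.
rewrite /cdeg card_sum_pred; congr (_ + _) => //.
rewrite -(card_pick1 u _ (fun y => F (inl u) (inr y) == i)); exact: eq_card.
Qed.

Lemma degree_pendant_l u :
  #|[pred y | pendant (inl u) y]| = degree e u + (k %| degree e u).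
Proof.
rewrite card_sum_pred; congr (_ + _) => //.
rewrite -[in RHS](andbT (k %| _)) -(card_pick1 u _ predT).
by apply: eq_card => y; rewrite !inE andbT.
Qed.

Lemma degree_pendant_r u :
  #|[pred y | pendant (inr u) y]| = (k %| degree e u).
Proof.
rewrite card_sum_pred [X in _ + X]eq_card0 ?addn0 //.
rewrite -[in RHS](andbT (k %| _)) -(card_pick1 u _ predT).
apply: eq_card => y; rewrite !inE /= andbT.
by have [->|ne] := eqVneq u y; rewrite ?eqxx // eq_sym (negbTE ne).
Qed.

End Pendant.

(* Deleting the pendant edge at a vertex of degree kq leaves colour degrees between
   q - 1 and q + 1. *)
Lemma bounded_colouring (T : finType) (e : rel T) (k r a : nat) :
    simple_graph e -> 0 < k ->
    (forall v, r * k < degree e v < (r + a) * k) ->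
  exists f : T -> T -> 'I_k, (forall x y, f x y = f y x) /\
    forall i v, r <= cdeg e f i v <= r + a.
Proof.
move=> [e_sym e_irr] k0 deg.
(* For k = 1 a pendant edge cannot destroy divisibility, but the only colour class is the whole
   graph. *)
have [k1|k1] := leqP k 1.
  have {k1 k0} kE : k = 1 by lia.
  subst k; exists (fun _ _ => ord0); split=> // i v; have := deg v.
  have -> : cdeg e (fun _ _ => ord0) i v = degree e v.
    by apply: eq_card => y; rewrite !inE (ord1 i) eqxx andbT.
  by rewrite !muln1; lia.
have [] := @equitable_colouring _ 'I_k _ (pendant_sym k e_sym) (pendant_irr k e_irr).
- by rewrite card_ord.
- rewrite card_ord; case=> u; rewrite ?degree_pendant_l ?degree_pendant_r.
    case: (boolP (k %| _)) => [kd|kd] _; last by rewrite addn0.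
    by rewrite dvdn_addr // dvdn1; lia.
  by case: (k %| _) => // _; rewrite dvdn1; lia.
move=> F [F_sym Feq]; exists (fun x y => F (inl x) (inl y)); split=> // i v.
have S := sum_cdeg (pendant e k) F (inl v).
rewrite degree_pendant_l in S.
have FE j := cdeg_pendant e F j v.
have := deg v; set D := degree e v in S FE * => /andP[lo hi].
have [q qE] : exists q, D = q * k + (if k %| D then 0 else D %% k).
  exists (D %/ k); rewrite {1}(divn_eq D k); congr (_ + _).
  by case: ifP => // /eqP.
(* One colour degree out of range forces, by equitability, a bound on all of them; their sum then
   contradicts the strict bounds on D. If k divides D, these bounds leave a gap of at least k, which
   absorbs the pendant edge. *)
apply/andP; split; rewrite leqNgt; apply/negP => bad.
- have : \sum_j cdeg (pendant e k) F j (inl v) <= \sum_(j : 'I_k) (r + (k %| D)).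
    apply: leq_sum => j _; have := Feq j i (inl v); rewrite (FE i).
    move: bad; case: (k %| D); case: (_ == i); rewrite /= ?addn0; lia.
  rewrite S sum_nat_const card_ord.
  move: qE; case: (k %| D) => qE; rewrite /= ?addn0 ?addn1; last by lia.
  have : r < q by rewrite -(ltn_pmul2r k0); lia.
  by rewrite -(leq_pmul2r k0); lia.
- have : \sum_(j : 'I_k) (r + a) <= \sum_j cdeg (pendant e k) F j (inl v).
    apply: leq_sum => j _; have := Feq i j (inl v); rewrite (FE i).
    by move: bad; case: (_ && _); rewrite /= ?addn0; lia.
  rewrite S sum_nat_const card_ord.
  move: qE; case: (k %| D) => qE; rewrite /= ?addn0 ?addn1; last by lia.
  have : q < r + a by rewrite -(ltn_pmul2r k0); lia.
  by rewrite -(leq_pmul2r k0); lia.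
Qed.

(** The factors are the colour classes of [bounded_colouring]. *)
Lemma has_factorization_range (T : finType) (e : rel T) (k r a : nat) :
    simple_graph e -> 0 < k -> (forall v, r * k < degree e v < (r + a) * k) ->
  has_factorization e r a k.
Proof.
move=> simple k0 /(bounded_colouring simple k0)[f [f_sym fE]].
have [e_sym e_irr] := simple; exists (fun i u w => e u w && (f u w == i)); split.
  move=> i; split.
  - by split=> [x y|x]; rewrite ?e_irr // e_sym f_sym.
  - by move=> x y /andP[].
  - by move=> v; apply: fE.
move=> u w euw; exists (f u w); split; first by rewrite euw eqxx.
by move=> i /andP[_ /eqP].
Qed.

Lemma sigma_bound_range (r s a t q : nat) : 0 < r -> 0 < t -> t * r + s + 1 <= a * q ->
  sigma_bound r s a t (r * q + (t - 1) * r + 1).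
Proof.
move=> r0 t0 aq d dN T e [simple deg].
(* The largest X with r X < d, so the lower degree bound holds for every number of factors up to
   X. *)
pose X := (d - 1) %/ r.
have Xlo : q + t - 1 <= X.
  by rewrite /X leq_divRL //; move: dN; rewrite mulnBl mulnBl mulnDl mul1n (mulnC q); nia.
have Xd : r * X <= d - 1 by rewrite mulnC leq_divM.
have dX : d - 1 < r * X + r by rewrite mulnC -mulSnr ltn_ceil.
have q0 : 0 < q by move: aq; case: (q) => //; rewrite muln0; lia.
exists (iota (X - t + 1) t); split; rewrite ?iota_uniq ?size_iota // => x.
rewrite mem_iota => /andP[x1 x2]; apply: has_factorization_range => //.
  by apply: leq_trans x1; rewrite addn1.
move=> v; have /andP[d1 d2] := deg v; apply/andP; split.
  apply: leq_trans d1; apply: leq_ltn_trans (_ : r * X < d).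
    by rewrite leq_mul2l; clear -x2 Xlo q0; lia.
  have d0 : 0 < d by apply: leq_trans dN; rewrite addn1.
  by clear -Xd d0; lia.
(* The upper bound is tightest for X - t + 1 factors. As X - t + 1 is at least q, (r + a)(X - t + 1)
   is at least r X - r (t - 1) + t r + s + 1 = r X + r + s + 1, which exceeds d + s. *)
apply: leq_ltn_trans d2 _; apply: leq_trans (_ : (r + a) * (X - t + 1) <= _).
  have -> : X - t + 1 = X - (t - 1) by clear -Xlo q0 t0; lia.
  rewrite mulnDl mulnBr.
  have h1 : a * q <= a * (X - (t - 1)) by rewrite leq_mul2l; clear -Xlo t0; lia.
  have h2 : r * (t - 1) <= r * X by rewrite leq_mul2l; clear -Xlo q0 t0; lia.
  have h3 : r * (t - 1) + r = t * r.
    by rewrite mulnC -mulSnr; congr (_ * _); clear -t0; lia.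
  by clear -h1 h2 h3 aq dX r0; lia.
by rewrite leq_mul2l x1 orbT.
Qed.

(** Classical, since [P] is an arbitrary proposition with no decision procedure. *)
Lemma least_nat (P : nat -> Prop) n : P n ->
  exists m, [/\ P m, m <= n & forall l, P l -> m <= l].
Proof.
elim/ltn_ind: n => n IHn Pn.
have [[m [mn Pm]]|none] := classic (exists m, m < n /\ P m).
  have [l [Pl lm least]] := IHn m mn Pm.
  by exists l; split=> //; apply: leq_trans lm (ltnW mn).
exists n; split=> // l Pl; rewrite leqNgt; apply/negP => ln.
by apply: none; exists l.
Qed.

Import Order.TTheory GRing.Theory Num.Theory.
Local Open Scope ring_scope.
Unset Implicit Arguments.

Theorem theorem22 (r a t s : nat) (hr : (1 <= r)%N) (ha : (2 <= a)%N)
    (ht : (1 <= t)%N) :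
  exists sigma : nat, is_sigma r s a t sigma /\
    sigma%:Z <= r%:Z * Num.ceil ((t * r + s + 1)%N%:R / a%:R : rat)
                + (t%:Z - 1) * r%:Z + 1.
Proof.
set c := Num.ceil _.
have a0 : (0 : rat) < a%:R by rewrite ltr0n; lia.
have c_ge : ((t * r + s + 1)%N : int) <= a%:Z * c.
  have := Num.Theory.ceil_ge ((t * r + s + 1)%N%:R / a%:R : rat).
  rewrite -/c ler_pdivrMr // => h.
  by rewrite -(ler_int rat) intrM mulrC.
(* The ceiling is nonnegative because its product with the positive [a] is, so it can serve as the
   natural number q of [sigma_bound_range]. *)
have [q qE] : exists q : nat, c = q.
  exists (absz c); rewrite gez0_abs //.
  by rewrite -(pmulr_rge0 (x := a%:Z)) ?ltz_nat; [apply: le_trans c_ge | lia].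
have aq : (t * r + s + 1 <= a * q)%N by move: c_ge; rewrite qE; lia.
have [m [Pm mn least]] := least_nat (sigma_bound_range hr ht aq).
exists m; split; first by [].
by rewrite qE; move: mn; rewrite -lez_nat; nia.
Qed.
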